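(* Let $q\in\mathbb N$, $r\in\mathbb N$, and let $\mathbf z_n=(z_i)_{i=0}^n$ denote either the uniform partition $\mathbf u_n$ or the Chebyshev partition $\mathbf t_n$ of $[-1,1]$. There is a constant $m_0=m_0(q,r)$ (depending only on $q$ and $r$) such that for each $s\in\mathcal S_{q+r}(\mathbf z_n)\cap\Delta^q\cap C^{q-1}[-1,1]$ and any $m\ge m_0 n$, there exists a spline $\tilde s\in\widetilde{\mathcal S}_{q+r}(\mathbf z_m)\cap\Delta^q$, where $\mathbf z_m$ is $\mathbf u_m$ or $\mathbf t_m$, respectively (i.e. of the same type as $\mathbf z_n$), satisfying \[ \|s-\tilde s\|_{L_p(\mathcal I_j)}\le c(p,q,r)\,\omega_{q+r+1}(s,\mathcal I_j)_p,\qquad 0\le j\le n, \] for all $0<p\le\infty$.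
   Context: $\mathbf u_n:=(-1+2j/n)_{j=0}^n$ and $\mathbf t_n:=(-\cos(j\pi/n))_{j=0}^n$. For a partition $\mathbf z_n=(z_i)_{i=0}^n$, $-1=z_0<\dots<z_n=1$, set $z_j:=z_0$ for $j<0$, $z_j:=z_n$ for $j>n$, and $\mathcal I_j:=[(z_{j-1}+z_j)/2,(z_j+z_{j+1})/2]$ (in the claim the $\mathcal I_j$ are those of $\mathbf z_n$). $\mathcal S_r(\mathbf z_n)$ is the space of piecewise polynomial functions of degree $r$ with knots $\mathbf z_n$: $s\in\mathcal S_r(\mathbf z_n)$ if on each $(z_i,z_{i+1})$, $0\le i\le n-1$, $s$ is an algebraic polynomial of degree $\le r$. $\widetilde{\mathcal S}_r(\mathbf z_n):=\mathcal S_r(\mathbf z_n)\cap C^{r-1}[-1,1]$. $\Delta^q=\Delta^q[-1,1]$ is the set of $q$-monotone functions on $[-1,1]$: all divided differences $[f;t_0,\dots,t_q]$ at $q+1$ distinct points of $[-1,1]$ are nonnegative. $L_p(J)$, $0<p\le\infty$: $\|f\|_{L_p(J)}=(\int_J|f|^p)^{1/p}$ for $p<\infty$, essential supremum for $p=\infty$. $\Delta_h^k(f,x,J)=\sum_{i=0}^k\binom ki(-1)^{k-i}f(x-kh/2+ih)$ if $x\pm kh/2\in J$, and $0$ otherwise; $\omega_k(f,t,J)_p=\sup_{0<h\le t}\|\Delta_h^k(f,\cdot,J)\|_{L_p(J)}$; $\omega_k(f,J)_p:=\omega_k(f,|J|,J)_p$ with $|J|$ the length of $J$. $c(\dots)$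 denotes a positive constant depending only on the parameters in parentheses. *)

(* Defs.v *)
From HB Require Import structures.
From mathcomp Require Import all_boot all_order all_algebra.
From mathcomp Require Import all_classical all_reals all_analysis.

Set Implicit Arguments.
Unset Strict Implicit.
Unset Printing Implicit Defensive.

Import Order.TTheory GRing.Theory Num.Theory.
Import numFieldNormedType.Exports.

Local Open Scope classical_set_scope.
Local Open Scope ring_scope.

(* Functions on an interval are represented by total functions [R -> R]; every
   definition below only looks at the values on the relevant interval. *)

Inductive partition_kind := Uniform | Chebyshev.

Definition knot (R : realType) (K : partition_kind) (n j : nat) : R :=
  match K with
  | Uniform => - 1 + 2 * j%:R / n%:R
  | Chebyshev => - cos (j%:R * pi / n%:R)
  end.

(* z_j := z_0 for j < 0 and z_j := z_n for j > n *)
Definition extend (R : realType) (z : nat -> R) (n : nat) (j : int) : R :=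
  match j with
  | Posz i => z (minn i n)
  | Negz _ => z 0%N
  end.

(* endpoints of the interval I_j attached to the partition z_0 < ... < z_n *)
Definition cell_left (R : realType) (z : nat -> R) (n j : nat) : R :=
  (extend z n (j%:Z - 1) + extend z n j%:Z) / 2.

Definition cell_right (R : realType) (z : nat -> R) (n j : nat) : R :=
  (extend z n j%:Z + extend z n (j%:Z + 1)) / 2.

(* The values at the knots are not constrained. *)
Definition piecewise_poly (R : realType) (d : nat) (z : nat -> R) (n : nat)
    (s : R -> R) : Prop :=
  forall i : nat, (i < n)%N ->
    exists2 P : {poly R}, (size P <= d.+1)%N &
      forall x : R, z i < x < z i.+1 -> s x = P.[x].

(* g is the derivative of f relative to [a, b]: one-sided at a and b *)
Definition derivative_on (R : realType) (a b : R) (f g : R -> R) : Prop :=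
  forall x : R, a <= x <= b ->
    (f y - f x) / (y - x) @[y --> within `[a, b] x^'] --> g x.

Fixpoint Ck (R : realType) (k : nat) (a b : R) (f : R -> R) : Prop :=
  match k with
  | 0%N => {within `[a, b], continuous f}
  | k'.+1 => exists2 g : R -> R, derivative_on a b f g & Ck k' a b g
  end.

Definition smooth_spline (R : realType) (d : nat) (z : nat -> R) (n : nat)
    (s : R -> R) : Prop :=
  piecewise_poly d z n s /\ Ck d.-1 (- 1) 1 s.

(* [f; t_0, ..., t_q] for pairwise distinct t_0, ..., t_q *)
Definition divided_difference (R : realType) (q : nat) (f : R -> R)
    (t : 'I_q.+1 -> R) : R :=
  \sum_(i < q.+1) f (t i) / \prod_(j < q.+1 | j != i) (t i - t j).

Definition q_monotone (R : realType) (q : nat) (a b : R) (f : R -> R) : Prop :=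
  forall t : 'I_q.+1 -> R, injective t -> (forall i, a <= t i <= b) ->
    0 <= divided_difference f t.

(* ||f||_{L_p(J)} as the norm over R of f extended by 0 outside J *)
Definition Lp_norm (R : realType) (p : \bar R) (J : set R) (f : R -> R) :
    \bar R :=
  'N[lebesgue_measure]_p[EFin \o (f \_ J)]%E.

Definition sym_difference (R : realType) (k : nat) (h : R) (f : R -> R)
    (J : set R) (x : R) : R :=
  if (x - k%:R * h / 2 \in J) && (x + k%:R * h / 2 \in J) then
    \sum_(i < k.+1)
      'C(k, i)%:R * (- 1) ^+ (k - i) * f (x - k%:R * h / 2 + i%:R * h)
  else 0.

Definition modulus (R : realType) (k : nat) (f : R -> R) (t : R) (J : set R)
    (p : \bar R) : \bar R :=
  ereal_sup [set Lp_norm p J (sym_difference k h f J) | h in `]0, t]].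

(* omega_k(f, J)_p for J = [a, b], i.e. with t = |J| = b - a *)
Definition modulus_itv (R : realType) (k : nat) (f : R -> R) (a b : R)
    (p : \bar R) : \bar R :=
  modulus k f (b - a) `[a, b] p.

(* Main.v *)
Require Import Defs.
From HB Require Import structures.
From mathcomp Require Import all_boot all_order all_algebra.
From mathcomp Require Import all_classical all_reals all_analysis.
From mathcomp Require Import ess_sup_inf.
From mathcomp Require Import ring lra zify.

Set Implicit Arguments.
Unset Strict Implicit.
Unset Printing Implicit Defensive.

Import Order.TTheory GRing.Theory Num.Theory.
Import numFieldNormedType.Exports.

Local Open Scope classical_set_scope.
Local Open Scope ring_scope.

(** The [q]-th derivative [g] of [s] is a nonnegative piecewise polynomial of
    degree [r] with jumps at the interior knots, and the corrections at distinct
    knots can be made independent: each one is supported well inside its cell.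
    Write [d = q + r]. Near a knot [z] separating the polynomials [P1] and [P2], put
    [F = P2 - P1], which vanishes to order [q] at [z]; a list of pairs [(c, t)] with
    [sum c (x - t)^d = F] gives a smooth transition
    [P1 + sum c (x - t)_+^d] from [P1] to [P2].
    - A list concentrated at scale [eta] around [z] makes an error of size at
      most [A |F|] in the [q]-th derivative, with [A] independent of [eta].
    - Adding [A |F|] times a bump equal to [1] at scale [eta] restores positivity
      there. Its [q]-fold antiderivative is, to the right, a polynomial of
      degree less than [q] and of size [O(eta)].
    - That polynomial is cancelled by a spline of size [O(eta |F|)] supported
      where [g] is at least a constant multiple of [|F|]; such an interval exists
      since [F^(q)] is a difference of two nonnegative pieces of [g]. Take [eta]
      small.

    Finally a single difference of order [d + 1], only the last node of which
    lies to the right of [z], equals [F], so the modulus of smoothness on the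
    cell is at least a constant multiple of the norm of [F], for every [p]. *)

(** The knots of [z_m] need not contain those of [z_n], so every break of [s] has to move to new
    knots. The ratio [m0] makes the new knots dense, relative to the local mesh size [H], around
    each interior old knot. After division by [H] all old knots become one model problem at [0],
    with constants from explicit interpolation bounds on coefficients. These constants are fixed in
    a definite order: the width of the interval where the derivative is large, then the cost of a
    correction there, then [eta], and last the knot density. Because each list sums exactly to the
    jump, nothing propagates to the next cell, and the error is a pointwise bound inside one cell.
    Hence one spline serves all exponents [p], which enter only through a power of a length; no
    triangle inequality in [L_p] is used, so exponents below 1 are treated like the others. *)

(** * The coefficient norm of a polynomial *)

Section CoefficientNorm.
Variable R : realFieldType.
Implicit Types (p : {poly R}) (x y : R).

(** Jumps are measured in this norm because it bounds values on [[-1, 1]] with constant 1. *)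
Definition cnorm p : R := \sum_(i < size p) `|p`_i|.

Lemma cnorm_widen N p : (size p <= N)%N -> cnorm p = \sum_(i < N) `|p`_i|.
Proof.
move=> sp; rewrite /cnorm (big_ord_widen N (fun i => `|p`_i|) sp) big_mkcond.
apply: eq_bigr => i _; case: ifPn => //; rewrite -leqNgt => h.
by rewrite nth_default // normr0.
Qed.

Lemma cnorm_ge0 p : 0 <= cnorm p.
Proof. by apply: sumr_ge0. Qed.

Lemma coef_le_cnorm p i : `|p`_i| <= cnorm p.
Proof.
rewrite (@cnorm_widen (maxn (size p) i.+1)) ?leq_maxl //.
have hi : (i < maxn (size p) i.+1)%N by rewrite leq_maxr.
by rewrite (bigD1 (Ordinal hi)) //= lerDl sumr_ge0.
Qed.

Lemma cnorm_le N p b : (size p <= N)%N -> (forall i, (i < N)%N -> `|p`_i| <= b) ->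
  cnorm p <= N%:R * b.
Proof.
move=> sp hb; rewrite (cnorm_widen sp).
apply: le_trans (_ : \sum_(i < N) b <= _).
  by apply: ler_sum => i _; apply: hb.
by rewrite sumr_const card_ord mulr_natl.
Qed.

Lemma cnormD p1 p2 : cnorm (p1 + p2) <= cnorm p1 + cnorm p2.
Proof.
pose N := maxn (size p1) (size p2).
rewrite (@cnorm_widen N) ?size_polyD //.
rewrite (@cnorm_widen N p1) ?leq_maxl // (@cnorm_widen N p2) ?leq_maxr //.
rewrite -big_split /=; apply: ler_sum => i _; rewrite coefD; exact: ler_normD.
Qed.


Lemma horner_le_cnorm p x : `|x| <= 1 -> `|p.[x]| <= cnorm p.
Proof.
move=> hx; rewrite horner_coef; apply: le_trans (ler_norm_sum _ _ _) _.
apply: ler_sum => i _; rewrite normrM normrX ler_piMr //.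
by rewrite exprn_ile1.
Qed.

Lemma exprn_lip k x y : `|x| <= 1 -> `|y| <= 1 ->
  `|x ^+ k - y ^+ k| <= k%:R * `|x - y|.
Proof.
move=> hx hy; rewrite subrXX normrM mulrC ler_wpM2r //.
apply: le_trans (ler_norm_sum _ _ _) _.
apply: le_trans (_ : \sum_(i < k) (1 : R) <= _).
  apply: ler_sum => i _; rewrite normrM !normrX mulr_ile1 ?exprn_ge0 //.
    by rewrite exprn_ile1.
  by rewrite exprn_ile1.
by rewrite sumr_const card_ord.
Qed.

Lemma horner_lip N p x y : (size p <= N)%N -> `|x| <= 1 -> `|y| <= 1 ->
  `|p.[x] - p.[y]| <= N%:R * cnorm p * `|x - y|.
Proof.
move=> sp hx hy; rewrite !horner_coef -sumrB.
apply: le_trans (ler_norm_sum _ _ _) _.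
rewrite /cnorm mulr_sumr mulr_suml; apply: ler_sum => i _.
rewrite -mulrBr normrM [N%:R * _]mulrC -mulrA ler_wpM2l //.
apply: le_trans (exprn_lip _ hx hy) _; rewrite ler_wpM2r // ler_nat.
by apply: leq_trans sp; apply: ltnW.
Qed.

Lemma poly_horner_inj p1 p2 : (forall x, p1.[x] = p2.[x]) -> p1 = p2.
Proof.
move=> h; apply/eqP; rewrite -subr_eq0; apply/eqP.
pose s := [seq i%:R : R | i <- iota 0 (size (p1 - p2)%R)].
apply: (@roots_geq_poly_eq0 _ _ s); last by rewrite size_map size_iota.
  by apply/allP => x _; rewrite rootE !hornerE h subrr.
rewrite map_inj_uniq ?iota_uniq // => i j /eqP.
by rewrite eqr_nat => /eqP.
Qed.

End CoefficientNorm.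

Lemma coef_exp_XsubC (R : comNzRingType) (c : R) N m : (m <= N)%N ->
  (('X - c%:P) ^+ N)`_m = 'C(N, m)%:R * (- c) ^+ (N - m).
Proof.
move=> hm; rewrite -[('X - _)]addrC -polyCN exprDn_comm; last exact: mulrC.
rewrite coef_sum (bigD1 (inord m)) //= inordK ?ltnS //.
rewrite coefMn -polyC_exp coefCM coefXn eqxx mulr1 big1 ?addr0 ?mulr_natl //.
move=> j nj; rewrite coefMn -polyC_exp coefCM coefXn.
have /negbTE -> : m != j :> nat.
  by apply: contra nj => /eqP ->; rewrite inord_val.
by rewrite mulr0 mul0rn.
Qed.

(** * Lagrange interpolation and systems of shifted powers *)

Section Lagrange.
Variables (R : realFieldType) (N : nat).
Implicit Types (t : 'I_N.+1 -> R) (p : {poly R}).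

Definition lagrange t (i : 'I_N.+1) : {poly R} :=
  \prod_(j < N.+1 | j != i) ((t i - t j)^-1 *: ('X - (t j)%:P)).

Lemma lagrange_horner t i j : injective t -> (lagrange t i).[t j] = (i == j)%:R.
Proof.
move=> ti; rewrite /lagrange horner_prod; case: eqVneq => [<-|nij].
  rewrite big1 // => k nk; rewrite !hornerE mulVf // subr_eq0.
  by apply: contra nk => /eqP/ti ->.
by rewrite (bigD1 j) 1?eq_sym //= !hornerE subrr mulr0 mul0r.
Qed.

Lemma lagrange_scale t i : lagrange t i =
  (\prod_(j < N.+1 | j != i) (t i - t j))^-1 *:
  \prod_(j < N.+1 | j != i) ('X - (t j)%:P).
Proof.
by rewrite /lagrange scaler_prod prodfV.
Qed.

Lemma size_lagrange t i : (size (lagrange t i) <= N.+1)%N.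
Proof.
rewrite lagrange_scale (leq_trans (size_scale_leq _ _)) //.
rewrite -big_filter size_prod_XsubC ltnS.
rewrite size_filter -sum1_count sum1dep_card (eq_card (B := predC1 i)).
  by rewrite cardC1 card_ord.
by move=> j; rewrite !inE.
Qed.

Lemma poly_eq_nodes t p1 p2 : injective t ->
  (size p1 <= N.+1)%N -> (size p2 <= N.+1)%N ->
  (forall i, p1.[t i] = p2.[t i]) -> p1 = p2.
Proof.
move=> ti s1 s2 h; apply/eqP; rewrite -subr_eq0; apply/eqP.
apply: (@roots_geq_poly_eq0 _ _ [seq t i | i <- enum 'I_N.+1]).
- by apply/allP => x /mapP[i _ ->]; rewrite rootE !hornerE h subrr.
- by rewrite map_inj_uniq // enum_uniq.
- rewrite size_map size_enum_ord (leq_trans (size_polyD _ _)) //.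
  by rewrite size_polyN geq_max s1.
Qed.

Lemma lagrange_interp t p : injective t -> (size p <= N.+1)%N ->
  p = \sum_i p.[t i] *: lagrange t i.
Proof.
move=> ti sp; apply: (poly_eq_nodes ti) => // [|j].
  apply: (leq_trans (size_sum _ _ _)); apply/bigmax_leqP => i _.
  by rewrite (leq_trans (size_scale_leq _ _)) // size_lagrange.
rewrite horner_sum (bigD1 j) //= !hornerE lagrange_horner // eqxx mulr1.
rewrite big1 ?addr0 // => i /negbTE ni.
by rewrite !hornerE lagrange_horner // ni mulr0.
Qed.

(** A factor ['X - t_j] with [|t_j| <= rho] multiplies the bound on the weighted coefficients by at
    most [2 rho]. The weight [rho^k] makes the estimate invariant under scaling, as required for
    nodes clustered at scale [eta]. *)
Lemma lagrange_coef t i (rho sigma : R) k : 0 < sigma -> 0 <= rho ->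
  (forall j, `|t j| <= rho) -> (forall j1 j2, j1 != j2 -> sigma <= `|t j1 - t j2|) ->
  `|(lagrange t i)`_k| * rho ^+ k <= (2 * rho / sigma) ^+ N.
Proof.
move=> s0 r0 tr ts; rewrite /lagrange.
have -> : (2 * rho / sigma) ^+ N = \prod_(j < N.+1 | j != i) (2 * rho / sigma).
  rewrite prodr_const; congr (_ ^+ _);
    rewrite -[LHS]/(N.+1.-1) -[in LHS](card_ord N.+1).
  by rewrite -(cardC1 i); apply: eq_card => j; rewrite !inE.
move: k; apply: (big_rec2 (fun p b => forall k, `|p`_k| * rho ^+ k <= b)).
  move=> [|k]; rewrite coef1 /=; first by rewrite normr1 expr0 mulr1.
  by rewrite normr0 mul0r.
move=> j p b nj IH k; rewrite -scalerAl coefZ mulrBl coefB coefXM coefCM.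
have p0 m : 0 <= `|p`_m| * rho ^+ m by rewrite mulr_ge0 // exprn_ge0.
have b0 : 0 <= b by apply: le_trans (IH 0%N).
have h1 : `|(if k == 0 then 0 else p`_k.-1) - t j * p`_k| * rho ^+ k <= 2 * rho * b.
  apply: (@le_trans _ _ ((`|if k == 0 then 0 else p`_k.-1| + `|t j| * `|p`_k|) * rho
    ^+ k)).
    by rewrite ler_wpM2r ?exprn_ge0 // (le_trans (ler_normB _ _)) // normrM.
  rewrite mulrDl mulr2n 2!mulrDl mul1r lerD //.
    case: k => [|k] /=; first by rewrite normr0 mul0r mulr_ge0.
    by rewrite exprS mulrCA ler_wpM2l.
  by rewrite -mulrA ler_pM.
have h2 : `|t i - t j|^-1 <= sigma^-1.
  have hs : sigma <= `|t i - t j| by rewrite ts // eq_sym.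
  by rewrite lef_pV2 ?posrE // (lt_le_trans s0).
rewrite normrM normfV -[leLHS]mulrA.
have -> : 2 * rho / sigma * b = sigma^-1 * (2 * rho * b) by ring.
by rewrite ler_pM // ?mulr_ge0 ?exprn_ge0.
Qed.

Lemma coef_le_nodes t (sigma : R) p k : 0 < sigma -> sigma <= 2 ->
  (forall j, `|t j| <= 1) -> (forall j1 j2, j1 != j2 -> sigma <= `|t j1 - t j2|) ->
  (size p <= N.+1)%N ->
  `|p`_k| <= (2 / sigma) ^+ N * \sum_i `|p.[t i]|.
Proof.
move=> s0 s2 t1 ts sp.
have ti : injective t.
  move=> i j e; apply/eqP; apply: contraT => /ts.
  by rewrite e subrr normr0 leNgt s0.
rewrite [in leLHS](lagrange_interp ti sp) coef_sum.
apply: le_trans (ler_norm_sum _ _ _) _; rewrite mulr_sumr; apply: ler_sum => i _.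
rewrite coefZ normrM mulrC ler_wpM2r //.
by have := lagrange_coef i k s0 ler01 t1 ts; rewrite expr1n !mulr1.
Qed.

(** Comparing coefficients prescribes the moments [sum_i c_i t_i^k], a Vandermonde system whose
    inverse has the Lagrange coefficients as entries. The numbers [f k] in the proof are these
    moments, with the binomials divided out. *)
Lemma power_system_solve t (rho sigma : R) p : 0 < sigma -> 0 <= rho ->
  (forall j, `|t j| <= rho) -> (forall j1 j2, j1 != j2 -> sigma <= `|t j1 - t j2|) ->
  (size p <= N.+1)%N ->
  exists c : 'I_N.+1 -> R,
    \sum_i c i *: ('X - (t i)%:P) ^+ N = p /\
    forall i, `|c i| * rho ^+ N <=
      (2 * rho / sigma) ^+ N * \sum_(k < N.+1) `|p`_k| * rho ^+ k.
Proof.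
move=> s0 r0 tr ts sp.
have ti : injective t.
  move=> i j e; apply/eqP; apply: contraT => /ts.
  by rewrite e subrr normr0 leNgt s0.
pose f k := (-1) ^+ k * p`_(N - k) / 'C(N, k)%:R.
(* The identity [sum_i t_i^l lagrange_i = 'X^l] is read coefficientwise. *)
exists (fun i => \sum_(k < N.+1) f k * (lagrange t i)`_k); split.
  apply/polyP => m; rewrite coef_sum; case: (leqP m N) => hm; last first.
    rewrite big1 ?nth_default ?(leq_trans sp) // => i _.
    rewrite coefZ nth_default ?mulr0 // (leq_trans _ hm) //.
    by rewrite size_exp_XsubC.
  have bm : 'C(N, m)%:R != 0 :> R by rewrite pnatr_eq0 -lt0n bin_gt0.
  have cf i : (('X - (t i)%:P) ^+ N)`_m = 'C(N,
    m)%:R * (-1) ^+ (N - m) * t i ^+ (N - m).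
    by rewrite coef_exp_XsubC // -mulrA -exprNn.
  under eq_bigr do rewrite coefZ cf mulr_suml.
  rewrite exchange_big /=.
  have hmN : (N - m < N.+1)%N by rewrite ltnS leq_subr.
  transitivity (\sum_(k < N.+1) f k * 'C(N, m)%:R * (-1) ^+ (N - m) *
     (\sum_i t i ^+ (N - m) *: lagrange t i)`_k).
    apply: eq_bigr => k _; rewrite coef_sum mulr_sumr; apply: eq_bigr => i _.
    by rewrite coefZ; ring.
  have <- : 'X^(N - m) = \sum_i t i ^+ (N - m) *: lagrange t i.
    rewrite [LHS](lagrange_interp ti) ?size_polyXn //.
    by apply: eq_bigr => i _; rewrite hornerXn.
  rewrite (bigD1 (Ordinal hmN)) //= coefXn eqxx big1 ?addr0.
    rewrite /f subKn // bin_sub // mulr1.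
    have : (-1) ^+ (N - m) * (-1) ^+ (N - m) = 1 :> R by rewrite -expr2 sqrr_sign.
    by move: ((-1) ^+ (N - m)) => e ee; field: ee.
  move=> k nk; rewrite coefXn; case: eqP => [e|]; last by rewrite mulr0.
  by case/negP: nk; apply/eqP/val_inj.
move=> i; apply: (@le_trans _ _ (\sum_(k < N.+1) (`|f k| * rho ^+ (N - k)) *
    (`|(lagrange t i)`_k| * rho ^+ k))).
  apply: le_trans (_ : (\sum_(k < N.+1) `|f k| * `|(lagrange t i)`_k|) * rho ^+ N <= _).
    rewrite ler_wpM2r ?exprn_ge0 // (le_trans (ler_norm_sum _ _ _)) //.
    by apply: ler_sum => k _; rewrite normrM.
  rewrite mulr_suml; apply: ler_sum => k _.
  have kN : (k <= N)%N by rewrite -ltnS.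
  have e : rho ^+ (N - k) * rho ^+ k = rho ^+ N by rewrite -exprD subnK.
  by rewrite -e mulrACA lexx.
rewrite mulr_sumr [leRHS](reindex_inj rev_ord_inj) /=; apply: ler_sum => k _.
have kN : (k <= N)%N by rewrite -ltnS.
rewrite subSS [leRHS]mulrC ler_pM ?mulr_ge0 ?exprn_ge0 //; last first.
  exact: lagrange_coef.
rewrite ler_wpM2r ?exprn_ge0 // /f normrM normrM normrX normrN1 expr1n mul1r.
rewrite ler_piMr // normfV invf_le1 normr_nat ?ler1n ?ltr0n bin_gt0 //.
Qed.

End Lagrange.

(** * Truncated powers and B-spline ramps *)

Section TruncatedPower.
Variable R : realFieldType.
Implicit Types (t : nat -> R) (x : R) (L : seq (R * R)).

Definition tpow (t : R) (k : nat) (x : R) : R := if t <= x then (x - t) ^+ k else 0.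

Lemma tpowS (t : R) k x : tpow t k.+1 x = (x - t) * tpow t k x.
Proof. by rewrite /tpow; case: ifP; rewrite ?mulr0 // exprS. Qed.

Lemma tpow_left (t : R) k x : x < t -> tpow t k x = 0.
Proof. by rewrite /tpow leNgt => ->. Qed.

Lemma tpow_right (t : R) k x : t <= x -> tpow t k x = (x - t) ^+ k.
Proof. by rewrite /tpow => ->. Qed.

Lemma tpow_ge0 (t : R) k x : 0 <= tpow t k x.
Proof. by rewrite /tpow; case: ifP => // h; rewrite exprn_ge0 // subr_ge0. Qed.

Lemma tpow_le (t : R) k x b : 0 <= b -> x - t <= b -> tpow t k x <= b ^+ k.
Proof.
move=> b0 h; rewrite /tpow; case: ifP => [tx|_]; last by rewrite exprn_ge0.
by rewrite lerXn2r // nnegrE // subr_ge0.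
Qed.

(* A list of pairs [(c, t)] encodes the spline [sum c (x - t)_+^k]. *)
Definition tsum k L x : R := \sum_(e <- L) e.1 * tpow e.2 k x.
Definition psum k L : {poly R} := \sum_(e <- L) e.1 *: ('X - e.2%:P) ^+ k.
Definition cost L : R := \sum_(e <- L) `|e.1|.

Lemma psum_horner k L x : (psum k L).[x] = \sum_(e <- L) e.1 * (x - e.2) ^+ k.
Proof.
by rewrite /psum horner_sum; apply: eq_bigr => e _; rewrite !hornerE.
Qed.

Lemma tsum_left k L x : (forall e, e \in L -> x < e.2) -> tsum k L x = 0.
Proof.
move=> h; rewrite /tsum big_seq big1 // => e /h eL.
by rewrite tpow_left ?mulr0.
Qed.

Lemma tsum_right k L x : (forall e, e \in L -> e.2 <= x) ->
  tsum k L x = (psum k L).[x].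
Proof.
move=> h; rewrite psum_horner /tsum big_seq [RHS]big_seq.
by apply: eq_bigr => e /h eL; rewrite tpow_right.
Qed.

Lemma derivn_exp_XsubC (c : R) m n : (n <= m)%N ->
  (('X - c%:P) ^+ m)^`(n) = (('X - c%:P) ^+ (m - n)) *+ (m ^_ n).
Proof.
elim: n => [|n IH] nm; first by rewrite derivn0 subn0 ffactn0 mulr1n.
rewrite derivnS IH ?(ltnW nm) // derivMn deriv_exp derivXsubC mul1r.
by rewrite -mulrnA mulnC ffactnSr subnS.
Qed.

Lemma derivn_psum q r L : (psum (q + r) L)^`(q) = ((q + r) ^_ q)%:R *: psum r L.
Proof.
rewrite /psum linear_sum scaler_sumr; apply: eq_bigr => e _.
rewrite linearZ /= derivn_exp_XsubC ?leq_addr // addKn.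
by rewrite scalerA mulrC -scalerA scaler_nat.
Qed.

Lemma size_psum k L : (size (psum k L) <= k.+1)%N.
Proof.
apply: (leq_trans (size_sum _ _ _)); apply/bigmax_leqP_seq => e _ _.
by rewrite (leq_trans (size_scale_leq _ _)) // size_exp_XsubC.
Qed.

Lemma tsum_le k L x b : 0 <= b -> (forall e, e \in L -> x - e.2 <= b) ->
  `|tsum k L x| <= cost L * b ^+ k.
Proof.
move=> b0 h; apply: le_trans (ler_norm_sum _ _ _) _; rewrite /cost mulr_suml.
rewrite big_seq [leRHS]big_seq; apply: ler_sum => e /h eL; rewrite normrM ler_wpM2l //.
by rewrite ger0_norm ?tpow_ge0 // tpow_le.
Qed.

Lemma tsum_cat k L1 L2 x : tsum k (L1 ++ L2) x = tsum k L1 x + tsum k L2 x.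
Proof. by rewrite /tsum big_cat. Qed.

Lemma psum_cat k L1 L2 : psum k (L1 ++ L2) = psum k L1 + psum k L2.
Proof. by rewrite /psum big_cat. Qed.

Lemma cost_cat L1 L2 : cost (L1 ++ L2) = cost L1 + cost L2.
Proof. by rewrite /cost big_cat. Qed.

Definition tscale (a : R) L := [seq (a * e.1, e.2) | e <- L].

Lemma tsum_scale a k L x : tsum k (tscale a L) x = a * tsum k L x.
Proof.
by rewrite /tsum big_map mulr_sumr; apply: eq_bigr => e _; rewrite mulrA.
Qed.

Lemma psum_scale a k L : psum k (tscale a L) = a *: psum k L.
Proof.
by rewrite /psum big_map scaler_sumr; apply: eq_bigr => e _; rewrite scalerA.
Qed.

Lemma cost_scale a L : cost (tscale a L) = `|a| * cost L.
Proof.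
by rewrite /cost big_map mulr_sumr; apply: eq_bigr => e _; rewrite normrM.
Qed.

Lemma mem_tscale a L e : e \in tscale a L -> exists2 e', e' \in L & e.2 = e'.2.
Proof. by case/mapP => e' h ->; exists e'. Qed.

Lemma tsum_indexed N (c t : 'I_N -> R) :
  exists L, [/\ forall e, e \in L -> exists i, e.2 = t i,
    forall k x, tsum k L x = \sum_i c i * tpow (t i) k x,
    forall k, psum k L = \sum_i c i *: ('X - (t i)%:P) ^+ k &
    cost L = \sum_i `|c i| ].
Proof.
exists [seq (c i, t i) | i <- enum 'I_N]; split.
- by move=> e /mapP[i _ ->]; exists i.
- by move=> k x; rewrite /tsum big_map big_enum.
- by move=> k; rewrite /psum big_map big_enum.
- by rewrite /cost big_map big_enum.
Qed.

(* Cox-de Boor recursion for the sum of the B-splines of order [k + 1] to the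
   right of [t_i]; it rises from 0 to 1 on [[t_i, t_(i+k)]]. *)
Fixpoint ramp t k i x : R :=
  if k is k'.+1 then
    ((x - t i) * ramp t k' i x + (t (i + k)%N - x) * ramp t k' i.+1 x)
      / (t (i + k)%N - t i)
  else (t i <= x)%R%:R.

(** Up to the sign [(-1)^k] these are the weights of the divided difference at [t_i, ..., t_(i+k)],
    which is applied here to [(x - .)_+^k]. *)
Fixpoint ramp_coef t k i l : R :=
  if k is k'.+1 then
    (ramp_coef t k' i l - ramp_coef t k' i.+1 l) / (t (i + k)%N - t i)
  else (l == i)%:R.

Section Ramp.
Variables (t : nat -> R) (M : nat) (sigma : R).
Hypotheses (sigma_gt0 : 0 < sigma)
  (t_gap : forall a b, (a < b <= M)%N -> sigma <= t b - t a).

Let t_neq a b : (a < b <= M)%N -> t b - t a != 0.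
Proof. by move=> h; rewrite gt_eqF // (lt_le_trans sigma_gt0) // t_gap. Qed.

(** With [a], [b] the two coefficients and [T = t_(i+k+1)], the left side equals [(x - t_i) a + (T -
    x) b - (x - t_l) (a - b)] for every [x]. Its vanishing lets the Cox-de Boor weights be traded
    for the factor [x - t_l]. *)
Lemma ramp_coef_balance k i l : (i + k.+1 <= M)%N ->
  ramp_coef t k i l * (t l - t i) +
  ramp_coef t k i.+1 l * (t (i + k.+1)%N - t l) = 0.
Proof.
elim: k i => [|k IH] i hM /=.
  rewrite addn1; case: (eqVneq l i) => [->|_].
    by rewrite (ltn_eqF (ltnSn i)) subrr mulr0 mul0r addr0.
  rewrite mul0r add0r; case: eqVneq => [->|_]; last by rewrite mul0r.
  by rewrite subrr mulr0.
have h1 := IH i; have h2 := IH i.+1.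
have n1 : t (i + k.+1)%N - t i != 0 by apply: t_neq; lia.
have n2 : t (i.+1 + k.+1)%N - t i.+1 != 0 by apply: t_neq; lia.
rewrite [in X in _ * (X - t l)](_ : i + k.+2 = i.+1 + k.+1)%N; last by lia.
have {}h1 : (i + k.+1 <= M)%N by lia.
move/IH: h1 => h1.
have {}h2 : (i.+1 + k.+1 <= M)%N by lia.
move/IH: h2 => h2.
set a := ramp_coef t k i l in h1 *; set b := ramp_coef t k i.+1 l in h1 h2 *.
set e := ramp_coef t k i.+2 l in h2 *.
have e1 : (a - b) * (t l - t i) = - b * (t (i + k.+1)%N - t i) by lra.
have e2 : (b - e) * (t (i.+1 + k.+1)%N - t l) = b * (t (i.+1 + k.+1)%N - t i.+1) by lra.
by rewrite mulrAC e1 mulfK // mulrAC e2 mulfK // addNr.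
Qed.

(** The family [f] is abstract so that the same step serves truncated powers and full powers. *)
Lemma ramp_coef_rec (f : nat -> nat -> R) N k i x : (i + k.+1 <= M)%N ->
  (forall l, f k.+1 l = (x - t l) * f k l) ->
  \sum_(l < N) ramp_coef t k.+1 i l * f k.+1 l =
  ((x - t i) * (\sum_(l < N) ramp_coef t k i l * f k l) +
   (t (i + k.+1)%N - x) * (\sum_(l < N) ramp_coef t k i.+1 l * f k l))
    / (t (i + k.+1)%N - t i).
Proof.
move=> hM hf; rewrite !mulr_sumr -big_split mulr_suml /=; apply: eq_bigr => l _.
have := ramp_coef_balance l hM; rewrite hf /= => hb.
rewrite [LHS]mulrAC; congr (_ / _).
set a := ramp_coef t k i l in hb *; set b := ramp_coef t k i.+1 l in hb *.
apply/eqP; rewrite -subr_eq0; apply/eqP.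
rewrite -[RHS](mulr0 (- f k l)) -hb; ring.
Qed.

Lemma ramp_expand N k i x : (i + k <= M)%N -> (i + k < N)%N ->
  ramp t k i x = \sum_(l < N) ramp_coef t k i l * tpow (t l) k x.
Proof.
elim: k i => [|k IH] i hM hN.
  have iN : (i < N)%N by lia.
  rewrite (bigD1 (Ordinal iN)) //= eqxx mul1r /tpow expr0 big1 ?addr0.
    by case: ifP.
  move=> l nl; case: eqP => [e|]; last by rewrite mul0r.
  by case/negP: nl; apply/eqP/val_inj.
rewrite (ramp_coef_rec (f := fun k l => tpow (t l) k x) _ hM (fun l => tpowS _ _ _)).
by rewrite /= IH ?IH //; lia.
Qed.

Lemma ramp_coef_sum N k i x : (i + k <= M)%N -> (i + k < N)%N ->
  \sum_(l < N) ramp_coef t k i l * (x - t l) ^+ k = 1.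
Proof.
elim: k i => [|k IH] i hM hN.
  have iN : (i < N)%N by lia.
  rewrite (bigD1 (Ordinal iN)) //= eqxx mul1r expr0 big1 ?addr0 //.
  move=> l nl; case: eqP => [e|]; last by rewrite mul0r.
  by case/negP: nl; apply/eqP/val_inj.
rewrite (ramp_coef_rec (f := fun k l => (x - t l) ^+ k) _ hM (fun l => exprS _ _)).
rewrite /= IH ?IH; [|lia..].
have n1 : t (i + k.+1)%N - t i != 0 by apply: t_neq; lia.
by field.
Qed.

Lemma ramp_coef_le k i l : (i + k <= M)%N ->
  `|ramp_coef t k i l| <= (2 / sigma) ^+ k.
Proof.
elim: k i => [|k IH] i hM /=.
  by rewrite expr0; case: eqP; rewrite ?normr1 ?normr0 ?ler01.
have g : sigma <= t (i + k.+1)%N - t i by apply: t_gap; lia.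
have ha : `|ramp_coef t k i l| <= (2 / sigma) ^+ k by apply: IH; lia.
have hb : `|ramp_coef t k i.+1 l| <= (2 / sigma) ^+ k by apply: IH; lia.
rewrite normrM normfV (gtr0_norm (lt_le_trans sigma_gt0 g)) exprSr mulrA ler_pM //.
- by rewrite invr_ge0 (le_trans (ltW sigma_gt0)).
- by apply: le_trans (ler_normB _ _) _; lra.
- by rewrite lef_pV2 // posrE (lt_le_trans sigma_gt0).
Qed.

(** Outside [[t_i, t_(i+k)]] the two ramps of lower order agree, both 0 or both 1; inside, the
    recursion is a convex combination of them. *)
Lemma ramp_bounds k i x : (i + k <= M)%N ->
  [/\ x < t i -> ramp t k i x = 0, t (i + k)%N <= x -> ramp t k i x = 1 &
      0 <= ramp t k i x <= 1].
Proof.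
elim: k i => [|k IH] i hM.
  rewrite addn0 /=; split; first by rewrite leNgt => ->.
    by move=> ->.
  by case: (t i <= x); rewrite ?lexx ?ler01.
have h1 : (i + k <= M)%N by lia.
have h2 : (i.+1 + k <= M)%N by lia.
have j1 : (i < i + k.+1 <= M)%N by lia.
have j2 : (i < i.+1 <= M)%N by lia.
have j3 : (i + k < i + k.+1 <= M)%N by lia.
have [l1 r1 b1] := IH _ h1; have [l2 r2 b2] := IH _ h2.
have w0 : 0 < t (i + k.+1)%N - t i.
  by rewrite (lt_le_trans sigma_gt0) // t_gap.
have i1 : t i < t i.+1.
  by rewrite -subr_gt0 (lt_le_trans sigma_gt0) // t_gap.
have ik : t (i + k)%N < t (i + k.+1)%N.
  by rewrite -subr_gt0 (lt_le_trans sigma_gt0) // t_gap.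
have wE : x - t i + (t (i + k.+1)%N - x) = t (i + k.+1)%N - t i by ring.
rewrite addSnnS in r2.
rewrite /=; split.
- by move=> h; rewrite l1 // l2 ?(lt_trans h) // !mulr0 addr0 mul0r.
- move=> h; rewrite r1 ?(le_trans (ltW ik)) // r2 // !mulr1.
  by rewrite wE divff // gt_eqF.
- case: (ltP x (t i)) => xi.
    by rewrite l1 // l2 ?(lt_trans xi) // !mulr0 addr0 mul0r lexx ler01.
  case: (lerP (t (i + k.+1)%N) x) => xk.
    rewrite r1 ?(le_trans (ltW ik)) // r2 // !mulr1.
    by rewrite wE divff ?lexx ?ler01 // gt_eqF.
  rewrite ler_pdivrMr // mul1r divr_ge0 ?(ltW w0) //=; first nra.
  by case/andP: b1 b2 => ? ? /andP[? ?]; rewrite addr_ge0 // mulr_ge0 //; lra.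
Qed.

End Ramp.

Lemma ramp_exists r (t : nat -> R) (sigma : R) : 0 < sigma ->
  (forall a b, (a < b <= r)%N -> sigma <= t b - t a) ->
  exists L, [/\ forall e, e \in L -> exists2 i, (i <= r)%N & e.2 = t i,
    cost L <= r.+1%:R * (2 / sigma) ^+ r, psum r L = 1 &
    forall x, 0 <= tsum r L x <= 1].
Proof.
move=> s0 gap.
have [L [LT Lt Lp Lc]] := tsum_indexed (fun i : 'I_r.+1 => ramp_coef t r 0 i)
  (fun i => t i).
exists L; split.
- by move=> e /LT[i ->]; exists i => //; rewrite -ltnS.
- rewrite Lc; apply: le_trans (_ : \sum_(i < r.+1) (2 / sigma) ^+ r <= _).
    by apply: ler_sum => i _; apply: (ramp_coef_le s0 gap).
  by rewrite sumr_const card_ord -[leLHS]mulr_natl.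
- apply: poly_horner_inj => x; rewrite Lp hornerC horner_sum.
  rewrite -(ramp_coef_sum (N := r.+1) s0 gap (k := r) (i := 0) x) //.
  by apply: eq_bigr => i _; rewrite !hornerE.
- move=> x; rewrite Lt -(ramp_expand s0 gap) //.
  by have [] := ramp_bounds s0 gap x (k := r) (i := 0) (leqnn _).
Qed.

End TruncatedPower.

(** * Smoothing a single jump at the origin *)

Section LocalSmoothing.
Variable R : realFieldType.
Implicit Types (p P F Q : {poly R}) (x y : R) (L : seq (R * R)) (T : R -> Prop).

(** If all node values were small, interpolation would make every coefficient small. *)
Lemma cnorm_le_nodes N (t : 'I_N.+1 -> R) (sigma : R) : 0 < sigma -> sigma <= 2 ->
  (forall j, `|t j| <= 1) -> (forall j1 j2, j1 != j2 -> sigma <= `|t j1 - t j2|) ->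
  exists2 K : R, 0 < K &
    forall p, (size p <= N.+1)%N -> exists i, cnorm p <= K * `|p.[t i]|.
Proof.
move=> s0 s2 t1 ts; set c := (2 / sigma) ^+ N.
have c0 : 0 < c by rewrite exprn_gt0 // divr_gt0.
have N0 : 0 < N.+1%:R :> R by rewrite ltr0n.
exists (N.+1%:R * (c * N.+1%:R)); first by rewrite !mulr_gt0.
move=> p sp; apply/existsP; apply: contraT; rewrite negb_exists => /forallP h.
have hp : cnorm p <= N.+1%:R * (c * \sum_i `|p.[t i]|).
  by apply: cnorm_le => // i _; apply: coef_le_nodes.
suff : N.+1%:R * (c * \sum_i `|p.[t i]|) < cnorm p by rewrite ltNge hp.
rewrite mulrA mulr_sumr.
apply: lt_le_trans (_ : \sum_(i < N.+1) cnorm p / N.+1%:R <= _).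
  apply: ltr_sum => [|i _]; first by apply/hasP; exists ord0 => //;
    apply: mem_index_enum.
  rewrite ltr_pdivlMr //; have := h i; rewrite -ltNge; apply: le_lt_trans.
  by rewrite le_eqVlt; apply/orP; left; apply/eqP; ring.
by rewrite sumr_const card_ord -[leLHS]mulr_natr divfK // gt_eqF.
Qed.

(** At one of the nodes the polynomial is comparable to its norm, and the Lipschitz bound preserves
    half of that value nearby. The node depends on [p]; the radius [rho] and the constant [c] do
    not. *)
Lemma plateau N (t : 'I_N.+1 -> R) (sigma rmax : R) : 0 < sigma -> sigma <= 2 ->
  (forall j, `|t j| <= 1) -> (forall j1 j2, j1 != j2 -> sigma <= `|t j1 - t j2|) ->
  0 < rmax ->
  exists rho c : R, [/\ 0 < rho <= rmax, 0 < c &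
    forall p, (size p <= N.+1)%N -> exists i, forall x, `|x| <= 1 ->
      `|x - t i| <= rho -> c * cnorm p <= `|p.[x]|].
Proof.
move=> s0 s2 t1 ts rm0; have [K K0 hK] := cnorm_le_nodes s0 s2 t1 ts.
have N0 : 0 < N.+1%:R :> R by rewrite ltr0n.
have h2 : 0 < (2 * K * N.+1%:R)^-1 by rewrite invr_gt0 !mulr_gt0.
exists (Num.min rmax (2 * K * N.+1%:R)^-1), (2 * K)^-1; split.
- by rewrite lt_min rm0 h2 ge_min lexx.
- by rewrite invr_gt0 mulr_gt0.
move=> p sp; have [i hi] := hK p sp; exists i => x x1.
rewrite le_min => /andP[_ hx].
have := horner_lip sp x1 (t1 i); have := cnorm_ge0 p; set n := cnorm p in hi *.
move=> n0 hl.
have h3 : `|p.[x] - p.[t i]| <= (2 * K)^-1 * n.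
  apply: le_trans hl _; apply: le_trans (_ : N.+1%:R * n * (2 * K * N.+1%:R)^-1 <= _).
    by rewrite ler_wpM2l // mulr_ge0 // ltW.
  by rewrite le_eqVlt; apply/orP; left; apply/eqP; field; rewrite !gt_eqF.
have h4 : K^-1 * n <= `|p.[t i]| by rewrite mulrC ler_pdivrMr // mulrC.
have h5 : `|p.[t i]| <= `|p.[x]| + `|p.[x] - p.[t i]|.
  by rewrite distrC -{1}(subrKC p.[x] p.[t i]) ler_normD.
have e : K^-1 * n = (2 * K)^-1 * n + (2 * K)^-1 * n by field; rewrite gt_eqF.
by lra.
Qed.

(** [T] stands for the rescaled knots of [z_m]. The radius [1/4] keeps the chosen knots inside the
    cell, which extends at least [1/2] to each side once the mesh size is 1. *)
Definition dense T (k : R) := forall x, `|x| <= 1 / 4 -> exists2 t, T t & `|t - x| <= k.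

(** The targets are spaced by [2 dl] with [dl = w / (4 (N + 1))]; moving each one by at most
    [dl / 2] to a point of [T] leaves gaps of at least [dl]. *)
Lemma dense_nodes T (k : R) N (b w : R) : dense T k -> 0 < w ->
  k <= w / (8 * N.+1%:R) -> - (1 / 4) <= b -> b + w <= 1 / 4 ->
  exists t : nat -> R,
    (forall i, (i <= N)%N -> T (t i) /\ b - w / 4 <= t i <= b + 3 * w / 4) /\
    (forall a c, (a < c <= N)%N -> w / (4 * N.+1%:R) <= t c - t a).
Proof.
move=> dT w0 kw b1 b2; have N0 : 0 < N.+1%:R :> R by rewrite ltr0n.
set dl := w / (4 * N.+1%:R).
have d0 : 0 < dl by rewrite divr_gt0 ?mulr_gt0.
have kd : k <= dl / 2 by rewrite (le_trans kw) // le_eqVlt /dl; apply/orP; left;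
  apply/eqP; field; rewrite gt_eqF.
have wd : w = 4 * dl * N.+1%:R by rewrite /dl; field; rewrite gt_eqF.
have pos i : (i <= N)%N -> dl * i%:R <= dl * N.+1%:R - dl.
  by move=> iN; rewrite -natr1 mulrDr mulr1 addrK ler_pM2l // ler_nat.
have /choice[t ht] : forall i : nat, exists t, (i <= N)%N -> T t /\
  `|t - (b + 2 * dl * i%:R)| <= k.
  move=> i; case: (leqP i N) => iN; last by exists 0.
  have [|t Tt h] := dT (b + 2 * dl * i%:R); last by exists t.
  have := pos i iN; have : 0 <= dl * i%:R by rewrite mulr_ge0 ?ler0n // ltW.
  by move=> *; rewrite ler_norml; lra.
exists t; split.
  move=> i iN; have [Tt] := ht i iN; split=> //; move: b0;
    rewrite ler_norml => /andP[h1 h2].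
  have := pos i iN; have : 0 <= dl * i%:R by rewrite mulr_ge0 ?ler0n // ltW.
  by move=> *; lra.
move=> a c /andP[ac cN]; have [_] := ht a (leq_trans (ltnW ac) cN); have [_] := ht c cN.
rewrite !ler_norml => /andP[h1 h2] /andP[h3 h4].
have : dl * a.+1%:R <= dl * c%:R by rewrite ler_pM2l // ler_nat.
by rewrite -natr1 mulrDr mulr1; lra.
Qed.

Lemma power_list N (t : nat -> R) (rho sigma : R) F : 0 < sigma -> 0 <= rho ->
  (forall i, (i <= N)%N -> `|t i| <= rho) ->
  (forall a c, (a < c <= N)%N -> sigma <= t c - t a) -> (size F <= N.+1)%N ->
  exists L, [/\ forall e, e \in L -> exists2 i, (i <= N)%N & e.2 = t i,
    psum N L = F &
    cost L * rho ^+ N <=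
      N.+1%:R * ((2 * rho / sigma) ^+ N * \sum_(k < N.+1) `|F`_k| * rho ^+ k)].
Proof.
move=> s0 r0 tr gap sF.
have [|j1 j2 n12|c [hc cb]] := @power_system_solve R N (fun i =>
  t i) rho sigma F s0 r0 _ _ sF.
- by move=> j; apply: tr; rewrite -ltnS.
- wlog lt12 : j1 j2 n12 / (j1 < j2)%N.
    move=> H; case: (ltngtP j1 j2) => h; first exact: H.
      by rewrite distrC H // eq_sym.
    by case/eqP: n12; apply: val_inj.
  rewrite distrC (le_trans (gap j1 j2 _)) ?ler_norm // lt12 /=.
  by rewrite -ltnS.
have [L [LT Lt Lp Lc]] := tsum_indexed c (fun i : 'I_N.+1 => t i).
exists L; split=> //.
- by move=> e /LT[i ->]; exists i => //; rewrite -ltnS.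
- by rewrite Lp.
rewrite Lc mulr_suml; set B := (X in _ <= _ * X).
apply: le_trans (_ : \sum_(i < N.+1) B <= _); first exact: ler_sum.
by rewrite sumr_const card_ord -[leLHS]mulr_natl.
Qed.

(* The nodes sit at distance comparable to [eta], so the transition from [0] to
   [F] has size [cnorm F] in the [q]-th derivative, uniformly in [eta]. *)
Lemma jump_list q r : exists2 C : R, 0 < C & forall T (k eta : R),
  dense T k -> 0 < eta <= 1 / 16 -> k <= eta / (8 * (q + r).+1%:R) ->
  forall F, (size F <= (q + r).+1)%N -> (forall i, (i < q)%N -> F`_i = 0) ->
  exists L, [/\ forall e, e \in L -> T e.2 /\ - (eta / 4) <= e.2 <= 3 * eta / 4,
    psum (q + r) L = F & cost L * eta ^+ r <= C * cnorm F].
Proof.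
set d := (q + r)%N; have N0 : 0 < d.+1%:R :> R by rewrite ltr0n.
exists (d.+1%:R * (8 * d.+1%:R) ^+ d); first by rewrite mulr_gt0 ?exprn_gt0 ?mulr_gt0.
move=> T k eta dT /andP[e0 e1] ke F sF F0.
have [||t [tT gap]] := dense_nodes (b := 0) dT e0 ke; [lra..|].
have sg0 : 0 < eta / (4 * d.+1%:R) by rewrite divr_gt0 ?mulr_gt0.
have tr i : (i <= d)%N -> `|t i| <= eta.
  by move=> /tT[_ /andP[h1 h2]]; rewrite ler_norml; lra.
have [L [LT Lp Lc]] := power_list sg0 (ltW e0) tr gap sF.
exists L; split=> //.
  by move=> e /LT[i iN ->]; have [Tt /andP[h1 h2]] := tT i iN; split=> //; lra.
(* The weighted sum of [|F_k| eta^k] starts at [k = q], so it is at most [eta^q cnorm F]. Cancelling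
   [eta^q] leaves [eta^r], the size of a truncated power of degree [r] near the knot. *)
have eq0 : 0 < eta ^+ q by rewrite exprn_gt0.
rewrite -(ler_pM2l eq0).
have -> : eta ^+ q * (cost L * eta ^+ r) = cost L * eta ^+ d by rewrite exprD; ring.
apply: le_trans Lc _.
have -> : 2 * eta / (eta / (4 * d.+1%:R)) = 8 * d.+1%:R by field; rewrite !gt_eqF.
have -> : eta ^+ q * (d.+1%:R * (8 * d.+1%:R) ^+ d * cnorm F) =
  d.+1%:R * ((8 * d.+1%:R) ^+ d * (eta ^+ q * cnorm F)) by ring.
rewrite ler_pM2l // ler_wpM2l ?exprn_ge0 ?mulr_ge0 //.
rewrite (cnorm_widen sF) mulr_sumr; apply: ler_sum => i _.
rewrite [leRHS]mulrC; case: (ltnP i q) => iq; first by rewrite F0 // normr0 !mul0r.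
by rewrite ler_wpM2l // ler_wiXn2l // ?ltW //; lra.
Qed.

(* A difference of two ramps; its [q]-fold antiderivative is a polynomial of
   degree less than [q] to the right, whose size tends to zero with [eta]. *)
Lemma bump_list q r : exists2 C : R, 0 < C & forall T (k eta : R),
  dense T k -> 0 < eta <= 1 / 16 -> k <= eta / (8 * (q + r).+1%:R) ->
  exists L, [/\ forall e, e \in L -> T e.2 /\ `|e.2| <= 2 * eta,
    (size (psum (q + r) L) <= q)%N, cnorm (psum (q + r) L) <= C * eta,
    cost L * eta ^+ r <= C &
    forall x, 0 <= tsum r L x /\ (`|x| < eta -> 1 <= tsum r L x)].
Proof.
set d := (q + r)%N; have N0 : 0 < d.+1%:R :> R by rewrite ltr0n.
have r0 : 0 < r.+1%:R :> R by rewrite ltr0n.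
pose B : R := \sum_(i < d.+1) 'C(d, i)%:R.
have B0 : 0 <= B by apply: sumr_ge0.
pose C1 : R := 2 * r.+1%:R * (8 * r.+1%:R) ^+ r.
have C10 : 0 < C1 by rewrite !mulr_gt0 ?exprn_gt0 ?mulr_gt0.
pose C2 : R := q%:R * (C1 * B * 2 ^+ r.+1).
have C20 : 0 <= C2 by rewrite !mulr_ge0 ?exprn_ge0 ?ler0n // ltW.
exists (C1 + C2); first lra.
move=> T k eta dT /andP[e0 e1] ke.
have ke' : k <= eta / (8 * r.+1%:R).
  apply: le_trans ke _; rewrite ler_pM2l // lef_pV2 ?posrE ?mulr_gt0 //.
  by rewrite ler_pM2l // ler_nat ltnS leq_addl.
(* With windows of width [eta], these offsets confine the nodes to [[-2 eta, -eta]] and, in the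
   second call, to [[eta, 2 eta]]. *)
have [||tl [tlT gapl]] := dense_nodes (b := - (7 * eta / 4)) dT e0 ke'; [lra..|].
have [||tr [trT gapr]] := dense_nodes (b := 5 * eta / 4) dT e0 ke'; [lra..|].
have sg0 : 0 < eta / (4 * r.+1%:R) by rewrite divr_gt0 ?mulr_gt0.
have [Ll [LlT Llc Llp Llb]] := ramp_exists sg0 gapl.
have [Lr [LrT Lrc Lrp Lrb]] := ramp_exists sg0 gapr.
have Lle e : e \in Ll -> T e.2 /\ - (2 * eta) <= e.2 <= - eta.
  by move=> /LlT[i iN ->]; have [Tt /andP[h1 h2]] := tlT i iN; split=> //; lra.
have Lre e : e \in Lr -> T e.2 /\ eta <= e.2 <= 2 * eta.
  by move=> /LrT[i iN ->]; have [Tt /andP[h1 h2]] := trT i iN; split=> //; lra.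
pose L := Ll ++ tscale (-1) Lr.
have LT e : e \in L -> T e.2 /\ `|e.2| <= 2 * eta.
  rewrite mem_cat => /orP[/Lle[Tt h]|/mem_tscale[e' /Lre[Tt h] ->]].
    by split=> //; rewrite ler_norml; lra.
  by split=> //; rewrite ler_norml; lra.
have Lc : cost L * eta ^+ r <= C1.
  rewrite cost_cat cost_scale normrN1 mul1r.
  have er : 0 < eta ^+ r by rewrite exprn_gt0.
  have -> : C1 = (2 * (r.+1%:R * (2 / (eta / (4 * r.+1%:R))) ^+ r)) * eta ^+ r.
    rewrite /C1 -!mulrA -exprMn; congr (_ * (_ * _ ^+ _)).
    by field; rewrite !gt_eqF.
  by rewrite ler_pM2r //; lra.
(* Both ramps end at 1, so their difference vanishes to the right. It is proportional to the [q]-th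
   derivative of [psum d L], which therefore has degree less than [q]. *)
have Lp0 : psum r L = 0 by rewrite psum_cat psum_scale Llp Lrp scaleN1r subrr.
have sL : (size (psum d L) <= q)%N.
  have h := derivn_psum q r L; rewrite Lp0 scaler0 in h.
  apply/leq_sizeP => j qj; have := coef_derivn q (psum d L) (j - q).
  rewrite h coef0 subnKC // => /esym/eqP; rewrite mulrn_eq0 => /orP[|/eqP //].
  by rewrite -leqn0 leqNgt ffact_gt0 qj.
exists L; split=> //.
- apply: le_trans (_ : C2 * eta <= _); last by rewrite ler_pM2r //; lra.
  have -> : C2 * eta = q%:R * (C1 * B * 2 ^+ r.+1 * eta) by rewrite /C2; ring.
  apply: cnorm_le => // i iq.
  have id : (i <= d)%N by rewrite (leq_trans (ltnW iq)) ?leq_addr.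
  (* The strict inequality is the source of smallness: a coefficient of degree [i < q] contains
     nodes to the power [d - i >= r + 1], against a cost of order [eta^-r]. *)
  have rd : (r < d - i)%N by rewrite ltn_subRL ltn_add2r.
  apply: le_trans (_ : cost L * (B * (2 * eta) ^+ r.+1) <= _).
    rewrite /psum coef_sum /cost mulr_suml; apply: le_trans (ler_norm_sum _ _ _) _.
    rewrite big_seq [leRHS]big_seq; apply: ler_sum => e /LT[_ he].
    rewrite coefZ normrM ler_wpM2l // coef_exp_XsubC //.
    rewrite normrM normrX normrN normr_nat ler_pM ?exprn_ge0 //.
      have id' : (i < d.+1)%N by [].
      by rewrite /B (bigD1 (Ordinal id')) //= lerDl sumr_ge0.
    apply: le_trans (_ : (2 * eta) ^+ (d - i) <= _).
      by rewrite lerXn2r // nnegrE; lra.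
    by rewrite ler_wiXn2l //; lra.
  have -> : cost L * (B * (2 * eta) ^+ r.+1) =
     (cost L * eta ^+ r) * (B * 2 ^+ r.+1 * eta) by rewrite exprMn !exprS; ring.
  have -> : C1 * B * 2 ^+ r.+1 * eta = C1 * (B * 2 ^+ r.+1 * eta) by ring.
  by rewrite ler_wpM2r // !mulr_ge0 ?exprn_ge0 // ltW.
- by lra.
- move=> x; rewrite tsum_cat tsum_scale mulN1r.
  have /andP[l0 l1] := Llb x; have /andP[b0 b1] := Lrb x.
  have right_one : - eta <= x -> tsum r Ll x = 1.
    move=> hx; rewrite tsum_right ?Llp ?hornerC // => e /Lle[_ /andP[_ h]].
    exact: le_trans h hx.
  have left_zero : x < eta -> tsum r Lr x = 0.
    move=> hx; rewrite tsum_left // => e /Lre[_ /andP[h _]].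
    exact: lt_le_trans hx h.
  split.
    case: (ltP x eta) => hx; first by rewrite left_zero // subr0.
    by rewrite right_one ?subr_ge0 //; lra.
  by rewrite ltr_norml => /andP[h1 h2]; rewrite left_zero // right_one ?subr0 // ltW.
Qed.

(** Since [rho] is fixed before [eta], the constant does not deteriorate as [eta] shrinks. To the
    right of the nodes the sum of degree [r] vanishes, being proportional to the [q]-th derivative
    of [- Q]. *)
Lemma correction_list q r (rho : R) : 0 < rho <= 1 / 64 ->
  exists2 C : R, 0 < C & forall T (k y : R),
  dense T k -> k <= rho / (8 * (q + r).+1%:R) -> `|y| <= 3 / 16 ->
  forall Q, (size Q <= q)%N ->
  exists L, [/\ forall e, e \in L -> T e.2 /\ `|e.2 - y| <= 3 * rho / 4,
    psum (q + r) L = - Q, cost L <= C * cnorm Q &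
    forall x, rho < `|x - y| -> tsum r L x = 0].
Proof.
set d := (q + r)%N; have N0 : 0 < d.+1%:R :> R by rewrite ltr0n.
move=> /andP[p0 p1].
have sg0 : 0 < rho / (4 * d.+1%:R) by rewrite divr_gt0 ?mulr_gt0.
exists (d.+1%:R * (2 * 1 / (rho / (4 * d.+1%:R))) ^+ d).
  by rewrite mulr_gt0 // exprn_gt0 // divr_gt0.
move=> T k y dT kr; rewrite ler_norml => /andP[y1 y2] Q sQ.
have [||t [tT gap]] := dense_nodes (b := y) dT p0 kr; [lra..|].
have tr i : (i <= d)%N -> `|t i| <= 1.
  by move=> /tT[_ /andP[h1 h2]]; rewrite ler_norml; lra.
have sQ' : (size (- Q) <= d.+1)%N by rewrite size_polyN (leq_trans sQ) // leqW //
  leq_addr.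
have [L [LT Lp Lc]] := power_list sg0 ler01 tr gap sQ'.
have Le e : e \in L -> T e.2 /\ `|e.2 - y| <= 3 * rho / 4.
  move=> /LT[i iN ->]; have [Tt /andP[h1 h2]] := tT i iN; split=> //.
  by rewrite ler_norml; lra.
exists L; split=> //.
  rewrite expr1n mulr1 in Lc; apply: le_trans Lc _; rewrite mulrA ler_wpM2l //.
    by rewrite mulr_ge0 ?exprn_ge0 ?divr_ge0 // ?ltW.
  rewrite (@cnorm_widen _ d.+1 Q); last by rewrite -size_polyN.
  by apply: ler_sum => i _; rewrite expr1n mulr1 coefN normrN.
move=> x; rewrite ltNge ler_norml negb_and -!ltNge => /orP[h|h].
  rewrite tsum_left // => e /Le[_]; rewrite ler_norml => /andP[h1 h2]; lra.
rewrite tsum_right; last by move=> e /Le[_]; rewrite ler_norml => /andP[h1 h2]; lra.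
have := derivn_psum q r L; rewrite Lp derivn_poly0 ?size_polyN // => /esym/eqP.
rewrite scaler_eq0 pnatr_eq0 -leqn0 leqNgt ffact_gt0 leq_addr /= => /eqP ->.
by rewrite horner0.
Qed.

Lemma cnorm_le_derivn q p : (forall i, (i < q)%N -> p`_i = 0) ->
  cnorm p <= cnorm p^`(q).
Proof.
move=> p0; rewrite (@cnorm_widen _ (q + size p) p) ?leq_addl //.
rewrite (@cnorm_widen _ (size p) p^`(q)); last first.
  by apply/leq_sizeP => j hj; rewrite coef_derivn nth_default ?mul0rn //
    (leq_trans hj) // leq_addl.
rewrite big_split_ord /= big1 ?add0r => [|i _]; last by rewrite p0 ?normr0.
apply: ler_sum => i _; rewrite coef_derivn normrMn -[leRHS]mulr_natr ler_peMr //.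
by rewrite ler1n ffact_gt0 leq_addr.
Qed.

Lemma cnorm_derivn_le q d : exists2 K : R, 0 < K &
  forall p, (size p <= d.+1)%N -> cnorm p^`(q) <= K * cnorm p.
Proof.
pose B : R := \sum_(i < d.+1) (i ^_ q)%:R.
have B0 : 0 <= B by apply: sumr_ge0.
have N0 : 0 < d.+1%:R :> R by rewrite ltr0n.
exists (d.+1%:R * (B + 1)); first by rewrite mulr_gt0 //; lra.
move=> p sp; rewrite -mulrA; apply: cnorm_le.
  apply/leq_sizeP => j hj; rewrite coef_derivn nth_default ?mul0rn // (leq_trans sp) //.
  exact: leq_trans hj (leq_addl _ _).
move=> j _; rewrite coef_derivn normrMn -[leLHS]mulr_natl.
case: (ltnP (q + j) d.+1) => hj; last first.
  by rewrite nth_default ?(leq_trans sp) // normr0 mulr0 mulr_ge0 ?cnorm_ge0 //; lra.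
apply: ler_pM => //; last exact: coef_le_cnorm.
by rewrite /B (bigD1 (Ordinal hj)) //= -addrA lerDl addr_ge0 // sumr_ge0.
Qed.

(** One of [P^(q)] and [(P + F)^(q)] carries at least half of [cnorm F]; its plateau is sought on
    the side of [0] where it is the active, nonnegative piece. The distance [1/8] separates the
    plateau from the transition zone. *)
Lemma plateau_choice q r : exists rho c : R, [/\ 0 < rho <= 1 / 64, 0 < c &
  forall P F, (size P <= (q + r).+1)%N -> (size F <= (q + r).+1)%N ->
    (forall i, (i < q)%N -> F`_i = 0) ->
    (forall x, - 1 <= x <= 0 -> 0 <= (P^`(q)).[x]) ->
    (forall x, 0 <= x <= 1 -> 0 <= ((P + F)^`(q)).[x]) ->
  exists y, (1 / 8 <= y <= 3 / 16 /\
      forall x, `|x - y| <= rho -> c * cnorm F <= ((P + F)^`(q)).[x]) \/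
    (- (3 / 16) <= y <= - (1 / 8) /\
      forall x, `|x - y| <= rho -> c * cnorm F <= (P^`(q)).[x])].
Proof.
have r0 : 0 < r.+1%:R :> R by rewrite ltr0n.
pose sg : R := (16 * r.+1%:R)^-1.
pose t (i : 'I_r.+1) : R := 1 / 8 + i%:R * sg.
have sg0 : 0 < sg by rewrite invr_gt0 mulr_gt0.
have sg1 : r.+1%:R * sg = 1 / 16 by rewrite /sg; field; rewrite gt_eqF.
have tb i : 1 / 8 <= t i <= 3 / 16.
  have : 0 <= i%:R * sg by rewrite mulr_ge0 // ?ler0n // ltW.
  have : i%:R * sg <= r.+1%:R * sg by rewrite ler_pM2r // ler_nat ltnW.
  by rewrite /t; lra.
have tsep (j1 j2 : 'I_r.+1) : j1 != j2 -> sg <= `|t j1 - t j2|.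
  wlog lt12 : j1 j2 / (j2 < j1)%N.
    move=> H n12; case: (ltngtP j2 j1) => h; first exact: H.
      by rewrite distrC H // eq_sym.
    by case/eqP: n12; apply: val_inj.
  move=> _; apply: le_trans (ler_norm _).
  have : j2.+1%:R * sg <= j1%:R * sg by rewrite ler_pM2r // ler_nat.
  by rewrite -natr1 mulrDl mul1r /t; lra.
have s2 : sg <= 2.
  by have : 1 * sg <= r.+1%:R * sg; [rewrite ler_pM2r // ler1n | lra].
have rm0 : 0 < 1 / 64 :> R by lra.
have [|rho1 [c1 [/andP[p1 q1] c10 h1]]] := plateau sg0 s2 _ tsep rm0.
  by move=> j; have := tb j; rewrite ler_norml; lra.
have [||rho2 [c2 [/andP[p2 q2] c20 h2]]] := @plateau r (fun i =>
  - t i) sg _ sg0 s2 _ _ rm0.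
- by move=> j; have := tb j; rewrite ler_norml; lra.
- by move=> j1 j2 /tsep; rewrite opprK [- _ + _]addrC distrC.
have rho0 : 0 < Num.min rho1 rho2 by rewrite lt_min p1.
exists (Num.min rho1 rho2), (Num.min c1 c2 / 2); split.
- by rewrite rho0 ge_min q1.
- by rewrite divr_gt0 // lt_min c10.
move=> P F sP sF F0 hP hPF.
have szd p : (size p <= (q + r).+1)%N -> (size p^`(q) <= r.+1)%N.
  move=> sp; apply/leq_sizeP => j hj; rewrite coef_derivn nth_default ?mul0rn //.
  by rewrite (leq_trans sp) // -addnS leq_add2l.
have key : cnorm F <= cnorm P^`(q) + cnorm (P + F)^`(q).
  apply: le_trans (cnorm_le_derivn F0) _.
  have -> : F^`(q) = - P^`(q) + (P + F)^`(q) by rewrite derivnD addKr.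
  apply: le_trans (cnormD _ _) _; rewrite lerD2r /cnorm size_polyN.
  by apply: ler_sum => i _; rewrite coefN normrN.
have cF := cnorm_ge0 F.
have mc1 : Num.min c1 c2 <= c1 by rewrite ge_min lexx.
have mc2 : Num.min c1 c2 <= c2 by rewrite ge_min lexx orbT.
have mc0 : 0 < Num.min c1 c2 by rewrite lt_min c10.
have mr1 : Num.min rho1 rho2 <= rho1 by rewrite ge_min lexx.
have mr2 : Num.min rho1 rho2 <= rho2 by rewrite ge_min lexx orbT.
move: (Num.min c1 c2) (Num.min rho1 rho2) mc0 mc1 mc2 mr1 mr2 rho0 =>
  c rho c0 cc1 cc2 rr1 rr2 rho0.
case: (lerP (cnorm F) (2 * cnorm (P + F)^`(q))) => hc.
  have sPF : (size (P + F)%R <= (q + r).+1)%N.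
    by rewrite (leq_trans (size_polyD _ _)) // geq_max sP.
  have [i hi] := h1 _ (szd _ sPF); exists (t i); left; split; first exact: tb.
  move=> x hx; have /andP[t1 t2] := tb i; move: (hx); rewrite ler_norml => /andP[x1 x2].
  have xx : 0 <= x <= 1 by clear -x1 x2 t1 t2 rr1 p1 q1; lra.
  have := hi x _ (le_trans hx rr1); rewrite [`|_.[x]|]ger0_norm ?(hPF _ xx) // => hh.
  apply: le_trans (hh _); last by rewrite ler_norml; clear -xx; lra.
  apply: le_trans (_ : c * cnorm (P + F)^`(q) <= _).
    by rewrite -mulrA ler_pM2l //; clear -hc; lra.
  by rewrite ler_wpM2r // cnorm_ge0.
have [i hi] := h2 _ (szd _ sP); exists (- t i); right; split.
  by have := tb i; clear => h; lra.
move=> x hx; have /andP[t1 t2] := tb i; move: (hx); rewrite ler_norml => /andP[x1 x2].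
have xx : -1 <= x <= 0 by clear -x1 x2 t1 t2 rr2 p2 q2; lra.
have := hi x _ (le_trans hx rr2); rewrite [`|_.[x]|]ger0_norm ?(hP _ xx) // => hh.
apply: le_trans (hh _); last by rewrite ler_norml; clear -xx; lra.
apply: le_trans (_ : c * cnorm P^`(q) <= _).
  by rewrite -mulrA ler_pM2l //; clear -hc key; lra.
by rewrite ler_wpM2r // cnorm_ge0.
Qed.


(** The model problem: the knot is [0], its neighbours are at distance at least 1, and the vanishing
    of the first [q] coefficients of [F] expresses [C^(q-1)] matching. Positivity is followed on all
    of [[- a, b]], while the new knots stay within [1/4]. *)
Lemma local_smoothing q r : exists k C : R, [/\ 0 < k, 0 < C &
  forall T, dense T k ->
  forall P F (a b : R), (size P <= (q + r).+1)%N -> (size F <= (q + r).+1)%N ->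
    (forall i, (i < q)%N -> F`_i = 0) -> 1 <= a -> 1 <= b ->
    (forall x, - a <= x <= 0 -> 0 <= (P^`(q)).[x]) ->
    (forall x, 0 <= x <= b -> 0 <= ((P + F)^`(q)).[x]) ->
  exists L, [/\ forall e, e \in L -> T e.2 /\ `|e.2| <= 1 / 4,
    psum (q + r) L = F, cost L <= C * cnorm F &
    forall x, - a <= x <= b ->
      0 <= (P^`(q)).[x] + ((q + r) ^_ q)%:R * tsum r L x]].
Proof.
have [rho [c [rho_bd c0 choose_y]]] := plateau_choice q r.
have [CJ CJ0 jumpP] := jump_list q r.
have [CB CB0 bumpP] := bump_list q r.
have [CG CG0 corrP] := correction_list q r rho_bd.
have [K K0 derivP] := cnorm_derivn_le q (q + r).
have /andP[rho0 rho1] := rho_bd.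
have N0 : 0 < (q + r).+1%:R :> R by rewrite ltr0n.
pose f : R := ((q + r) ^_ q)%:R.
have f1 : 1 <= f by rewrite ler1n ffact_gt0 leq_addr.
have f0 : 0 < f by apply: lt_le_trans f1.
(* The first term bounds the jump list at distance at most [2 eta] from its nodes. The second bounds
   how negative [P^(q)] can become when continued past [0], where only [(P + F)^(q)] is known to be
   nonnegative. *)
pose A : R := CJ * 2 ^+ r + K.
have A0 : 0 < A by rewrite addr_gt0 // mulr_gt0 // exprn_gt0.
have D0 : 0 < f * A * CG * CB by rewrite !mulr_gt0.
(* The second bound keeps the correction, of size [f A CG CB eta cnorm F], below the plateau value
   [c cnorm F]. *)
pose eta : R := Num.min (1 / 32) (c / (f * A * CG * CB)).
have eta0 : 0 < eta by rewrite lt_min !divr_gt0 ?mulr_gt0.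
have eta1 : eta <= 1 / 32 by rewrite ge_min lexx.
have eta2 : f * A * CG * CB * eta <= c.
  have : eta <= c / (f * A * CG * CB) by rewrite ge_min lexx orbT.
  by rewrite ler_pdivlMr // mulrC.
have er0 : 0 < eta ^+ r by rewrite exprn_gt0.
have eb : 0 < eta <= 1 / 16 by rewrite eta0 /=; lra.
clearbody eta.
pose k := Num.min eta rho / (8 * (q + r).+1%:R).
have k0 : 0 < k by rewrite divr_gt0 ?mulr_gt0 // lt_min eta0.
have ke : k <= eta / (8 * (q + r).+1%:R).
  by rewrite ler_pM2r ?invr_gt0 ?mulr_gt0 // ge_min lexx.
have kr : k <= rho / (8 * (q + r).+1%:R).
  by rewrite ler_pM2r ?invr_gt0 ?mulr_gt0 // ge_min lexx orbT.
clearbody k.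
exists k, (CJ / eta ^+ r + A * (CB / eta ^+ r + CG * (CB * eta))); split=> //.
  apply: addr_gt0; first exact: divr_gt0.
  by apply: mulr_gt0 => //; apply: addr_gt0; [apply: divr_gt0|rewrite !mulr_gt0].
move=> T dT P F a b sP sF F0 a1 b1 hP hPF.
have hP1 x : -1 <= x <= 0 -> 0 <= (P^`(q)).[x] by move=> hx; apply: hP; clear -a1 hx;
  lra.
have hPF1 x : 0 <= x <= 1 -> 0 <= ((P + F)^`(q)).[x] by move=> hx; apply: hPF;
  clear -b1 hx; lra.
have [y hy] := choose_y P F sP sF F0 hP1 hPF1.
have [LJ [LJT LJp LJc]] := jumpP T k eta dT eb ke F sF F0.
have [LB [LBT LBs LBn LBc LBb]] := bumpP T k eta dT eb ke.
have y1 : `|y| <= 3 / 16.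
  by case: hy => -[/andP[ya yb] _]; rewrite ler_norml; clear -ya yb; lra.
have y2 : 1 / 8 <= `|y|.
  by clear -hy; case: hy => -[/andP[ya yb] _]; rewrite ler_normr; clear -ya yb; lra.
have [LC [LCT LCp LCc LCz]] := corrP T k y dT kr y1 _ LBs.
have n0 := cnorm_ge0 F; set n := cnorm F in LJc hy n0 *.
have cB0 : 0 <= cnorm (psum (q + r) LB) := cnorm_ge0 _.
have LCc' : cost LC <= CG * (CB * eta) by apply: le_trans LCc _; rewrite ler_pM2l.
have LBc' : cost LB <= CB / eta ^+ r by rewrite ler_pdivlMr.
have LJc' : cost LJ <= CJ / eta ^+ r * n by rewrite mulrAC ler_pdivlMr.
exists (LJ ++ tscale (A * n) (LB ++ LC)); split.
- move=> e; rewrite mem_cat => /orP[/LJT[Te he]|].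
    by split=> //; rewrite ler_norml; clear -he eta1 eta0; lra.
  move=> /mem_tscale[e' + ->]; rewrite mem_cat => /orP[/LBT[Te he]|/LCT[Te he]].
    by split=> //; clear -he eta1; lra.
  by split=> //; move: he y1; rewrite !ler_norml; clear -rho1 => he y1; lra.
- by rewrite psum_cat psum_scale psum_cat LJp LCp subrr scaler0 addr0.
- rewrite cost_cat cost_scale cost_cat ger0_norm; last by rewrite mulr_ge0 // ltW.
  have h1 : A * n * (cost LB + cost LC) <= A * n * (CB / eta ^+ r + CG * (CB * eta)).
    by rewrite ler_wpM2l ?mulr_ge0 ?(ltW A0) // lerD.
  apply: le_trans (lerD LJc' h1) _.
  by rewrite le_eqVlt; apply/orP; left; apply/eqP; ring.
move=> x hx; rewrite tsum_cat tsum_scale tsum_cat -/f.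
have [Bge Bone] := LBb x.
have An0 : 0 <= A * n by rewrite mulr_ge0 // ltW.
have fAn0 : 0 <= f * (A * n) by rewrite mulr_ge0 // ltW.
rewrite [f * _]mulrDr addrA [f * (A * n * _)]mulrA.
(* In the transition zone the bump is at least 1 and the correction vanishes, since [|y| >= 1/8];
   elsewhere the jump list is either absent or complete. *)
case: (ltP `|x| eta) => hxe.
  have -> : tsum r LC x = 0.
    apply: LCz; have := lerB_dist y x; rewrite [`|y - x|]distrC.
    by clear -hxe y2 eta1 rho1 => h; lra.
  rewrite addr0; have {}Bone := Bone hxe.
  have hB : f * (A * n) * 1 <= f * (A * n) * tsum r LB x by rewrite ler_wpM2l.
  have hJ : `|tsum r LJ x| <= cost LJ * (2 * eta) ^+ r.
    apply: tsum_le; first by rewrite mulr_ge0 // ltW.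
    move=> e /LJT[_ he]; move: hxe; rewrite ltr_norml; clear -he eta0 => h; lra.
  have hJ' : `|tsum r LJ x| <= CJ * 2 ^+ r * n.
    apply: le_trans hJ _; have -> : cost LJ * (2 * eta) ^+ r = 2 ^+ r * (cost LJ *
      eta ^+ r).
      by rewrite exprMn; ring.
    have -> : CJ * 2 ^+ r * n = 2 ^+ r * (CJ * n) by ring.
    by rewrite ler_pM2l // exprn_gt0.
  have hP0 : - (K * n) <= (P^`(q)).[x].
    case: (lerP x 0) => x0.
      apply: le_trans (hP1 x _); first by rewrite oppr_le0 mulr_ge0 // ltW.
      by move: hxe; rewrite ltr_norml; clear -x0 eta1 => h; lra.
    have : 0 <= ((P + F)^`(q)).[x].
      by apply: hPF1; move: hxe; rewrite ltr_norml; clear -x0 eta1 => h; lra.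
    rewrite derivnD hornerD.
    have hx1 : `|x| <= 1 by clear -hxe eta1; lra.
    have := le_trans (horner_le_cnorm (F^`(q)) hx1) (derivP F sF).
    rewrite ler_norml -/n; clear => h1 h2; lra.
  have hKn : K * n <= f * (K * n) by rewrite ler_peMl // mulr_ge0 // ltW.
  have hJ2 : - (f * (CJ * 2 ^+ r * n)) <= f * tsum r LJ x.
    by rewrite -mulrN ler_pM2l //; move: hJ'; rewrite ler_norml => /andP[].
  have hA : f * (A * n) = f * (CJ * 2 ^+ r * n) + f * (K * n) by rewrite /A; ring.
  by clear -hA hJ2 hKn hP0 hB; lra.
have [main0 mainl mainr] : [/\ 0 <= (P^`(q)).[x] + f * tsum r LJ x,
    x < 0 -> (P^`(q)).[x] + f * tsum r LJ x = (P^`(q)).[x] &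
    0 <= x -> (P^`(q)).[x] + f * tsum r LJ x = ((P + F)^`(q)).[x]].
  case: (ltP x 0) => x0.
    have -> : tsum r LJ x = 0.
      apply: tsum_left => e /LJT[_ /andP[he1 he2]].
      by move: hxe; rewrite ltr0_norm //; clear -he1 eta0 => h; lra.
    rewrite mulr0 addr0; split=> //.
    by apply: hP; move/andP: hx => [-> _]; rewrite ltW.
  have e1 : (P^`(q)).[x] + f * tsum r LJ x = ((P + F)^`(q)).[x].
    rewrite tsum_right.
      by rewrite derivnD hornerD -LJp derivn_psum hornerZ.
    move=> e /LJT[_ /andP[he1 he2]]; move: hxe; rewrite ger0_norm //;
      clear -he2 eta0 => h; lra.
  rewrite e1; split=> //; first by apply: hPF; move/andP: hx => [_ ->]; rewrite x0.
case: (ltP rho `|x - y|) => hxy.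
  by rewrite (LCz _ hxy) addr0 addr_ge0 // mulr_ge0.
have hC : `|tsum r LC x| <= cost LC * 1 ^+ r.
  apply: tsum_le => // e /LCT[_ he].
  by move: he hxy; rewrite !ler_norml; clear -rho0 rho1 => h1 h2; lra.
rewrite expr1n mulr1 in hC.
have hC2 : - (c * n) <= f * (A * n) * tsum r LC x.
  have h1 : `|f * (A * n) * tsum r LC x| <= f * (A * n) * (CG * (CB * eta)).
    by rewrite normrM ger0_norm // ler_wpM2l // (le_trans hC).
  have h2 : f * (A * n) * (CG * (CB * eta)) = f * A * CG * CB * eta * n by ring.
  have h3 : f * A * CG * CB * eta * n <= c * n by rewrite ler_wpM2r.
  by move: h1; rewrite ler_norml; clear -h2 h3 => h1; lra.
have hB2 : 0 <= f * (A * n) * tsum r LB x by rewrite mulr_ge0.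
have main_c : c * n <= (P^`(q)).[x] + f * tsum r LJ x.
  case: hy => -[/andP[ya yb] hc]; have := hc x hxy.
    by rewrite mainr //; move: hxy; rewrite ler_norml; clear -ya rho1 => h; lra.
  by rewrite mainl //; move: hxy; rewrite ler_norml; clear -yb rho1 => h; lra.
by rewrite mulrDr; clear -main_c hC2 hB2; lra.
Qed.

End LocalSmoothing.

(** * Divided differences and the sign of the [q]-th derivative *)

Section DividedDifferences.
Variable R : realType.

Lemma rolle_iterated (k : nat) (g : nat -> R -> R) (a b : R) (x : nat -> R) :
  (forall i, (i < k)%N -> forall y : R, is_derive y (1 : R) (g i) (g i.+1 y)) ->
  (forall i, (i < k)%N -> x i < x i.+1) ->
  (forall i, (i <= k)%N -> a <= x i <= b /\ g 0%N (x i) = 0) ->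
  exists2 y, a <= y <= b & g k y = 0.
Proof.
elim: k g x => [|k IH] g x dg xx hx.
  by have [h1 h2] := hx 0%N (leqnn _); exists (x 0%N).
have /choice[y hy] : forall i, exists y, (i <= k)%N -> x i < y < x i.+1 /\ g 1%N y = 0.
  move=> i; case: (leqP i k) => ik; last by exists 0.
  have [_ zi] := hx i (leqW ik); have [_ zi1] := hx i.+1 ik.
  have dg0 := dg 0%N (ltn0Sn _).
  have [||||c cI dc] := @Rolle R (g 0%N) (x i) (x i.+1).
  - exact: xx.
  - by move=> c _; case: (dg0 c).
  - apply: continuous_subspaceT => c; apply: differentiable_continuous.
    by apply/derivable1_diffP; case: (dg0 c).
  - by rewrite zi zi1.
  exists c => _; split; first by move: cI; rewrite in_itv.
  by case: (dg0 c) => _ <-; case: dc => _ ->.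
apply: (IH (fun i => g i.+1) y).
- by move=> i ik; apply: dg.
- move=> i ik; have [/andP[_ h1] _] := hy i (ltnW ik);
  have [/andP[h2 _] _] := hy i.+1 ik.
  exact: lt_trans h1 h2.
- move=> i ik; have [/andP[h1 h2] h3] := hy i ik; split=> //.
  have [/andP[h4 _] _] := hx i (leqW ik); have [/andP[_ h5] _] := hx i.+1 ik.
  by rewrite (le_trans h4 (ltW h1)) (le_trans (ltW h2) h5).
Qed.

Lemma divided_difference_lead (q : nat) (f : R -> R) (t : 'I_q.+1 -> R) :
  divided_difference f t = (\sum_i f (t i) *: lagrange t i)`_q.
Proof.
rewrite coef_sum; apply: eq_bigr => i _; rewrite coefZ lagrange_scale coefZ.
congr (_ * _); rewrite -[LHS]mulr1; congr (_ * _).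
have /monicP := monic_prod_XsubC (index_enum 'I_q.+1) (fun j => j != i) t.
move=> <-; rewrite /lead_coef -big_filter size_prod_XsubC /= size_filter.
rewrite -sum1_count sum1dep_card (eq_card (B := predC1 i)) ?cardC1 ?card_ord //.
by move=> j; rewrite !inE.
Qed.

(** Subtracting the interpolating polynomial leaves a function with [q + 1] zeros, so iterated Rolle
    gives a zero of its [q]-th derivative. For the interpolant that derivative is constant, [q!]
    times the divided difference. The nodes come in arbitrary order and are sorted first. *)
Lemma divided_difference_mean (q : nat) (g : nat -> R -> R) (a b : R)
    (t : 'I_q.+1 -> R) :
  (forall i, (i < q)%N -> forall y : R, is_derive y (1 : R) (g i) (g i.+1 y)) ->
  injective t -> (forall i, a <= t i <= b) ->
  exists2 y, a <= y <= b & divided_difference (g 0%N) t * q`!%:R = g q y.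
Proof.
move=> dg ti tab; pose p := \sum_i g 0%N (t i) *: lagrange t i.
have sp : (size p <= q.+1)%N.
  apply: (leq_trans (size_sum _ _ _)); apply/bigmax_leqP => i _.
  by rewrite (leq_trans (size_scale_leq _ _)) // size_lagrange.
have pt i : p.[t i] = g 0%N (t i).
  rewrite horner_sum (bigD1 i) //= hornerZ lagrange_horner // eqxx mulr1.
  rewrite big1 ?addr0 // => j /negbTE nj.
  by rewrite hornerZ lagrange_horner // nj mulr0.
pose s := sort <=%R (codom t).
have us : uniq s by rewrite sort_uniq; apply/injectiveP.
have ss : sorted <%R s by rewrite lt_sorted_uniq_le us sort_le_sorted.
have szs : size s = q.+1 by rewrite size_sort size_codom card_ord.
have [|||y yab hy] := @rolle_iterated q (fun i y => g i y - p^`(i).[y]) a b (nth 0 s).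
- move=> i iq y; have h1 := dg i iq y; have := is_derive_poly p^`(i) y.
  rewrite -derivnS => h2; exact: is_deriveB.
- by move=> i iq; apply: (sorted_ltn_nth lt_trans) => //;
  rewrite inE szs // ltnW // ltnS.
- move=> i iq; have : nth 0 s i \in s by rewrite mem_nth // szs.
  rewrite mem_sort => /codomP[j ->]; split; first exact: tab.
  by rewrite derivn0 pt subrr.
exists y => //; move/eqP: hy; rewrite subr_eq0 => /eqP ->.
have -> : p^`(q) = (p`_q * q`!%:R)%:P.
  apply/polyP => i; rewrite coef_derivn coefC; case: i => [|i] /=.
    by rewrite addn0 ffactnn mulr_natr.
  by rewrite nth_default ?mul0rn // (leq_trans sp) // addnS ltnS leq_addr.
by rewrite hornerC divided_difference_lead.
Qed.

Lemma q_monotone_derive (q : nat) (g : nat -> R -> R) (a b : R) :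
  (forall i, (i < q)%N -> forall y : R, is_derive y (1 : R) (g i) (g i.+1 y)) ->
  (forall y, a <= y <= b -> 0 <= g q y) -> q_monotone q a b (g 0%N).
Proof.
move=> dg g0 t ti tab; have [y yab hy] := divided_difference_mean dg ti tab.
by rewrite -(pmulr_lge0 _ (x := q`!%:R)) ?ltr0n ?fact_gt0 // hy g0.
Qed.

(** If [p^(q)] were negative at a point, it would be so on a small interval, and the mean value form
    would give a negative divided difference of [f]. The nodes are taken strictly inside, because
    [f] agrees with [p] on the open interval only. *)
Lemma q_monotone_poly (q : nat) (f : R -> R) (p : {poly R}) (a b u v : R) :
  q_monotone q a b f -> a <= u -> u < v -> v <= b ->
  (forall x, u < x < v -> f x = p.[x]) ->
  forall x, u <= x <= v -> 0 <= p^`(q).[x].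
Proof.
move=> fq au uv vb fp x xuv; rewrite leNgt; apply/negP => px.
have e0 : 0 < - p^`(q).[x] by rewrite oppr_gt0.
have /cvgrPdist_lt /(_ _ e0) /nbhs_ballP[e /= e1 he] := @continuous_horner R p^`(q) x.
have neg y : `|x - y| < e -> p^`(q).[y] < 0.
  by move=> /he /=; rewrite ltr_norml => /andP[h _]; lra.
pose u' := Num.max u (x - e / 2); pose v' := Num.min v (x + e / 2).
have [xu xv] := andP xuv.
have uu : u <= u' by rewrite le_max lexx.
have vv : v' <= v by rewrite ge_min lexx.
have ux : x - e / 2 <= u' by rewrite le_max lexx orbT.
have vx : v' <= x + e / 2 by rewrite ge_min lexx orbT.
have uv' : u' < v' by rewrite lt_min !gt_max uv /=; apply/and3P; split; lra.
clearbody u' v'.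
pose w := (v' - u') / q.+2%:R.
have w0 : 0 < w by rewrite divr_gt0 ?subr_gt0 ?ltr0n.
have wE : q.+2%:R * w = v' - u' by rewrite mulrC divfK // pnatr_eq0.
pose t (i : 'I_q.+1) := u' + i.+1%:R * w.
have ti : injective t.
  move=> i j /addrI /(mulIf (lt0r_neq0 w0)) /eqP.
  by rewrite eqr_nat eqSS => /eqP/val_inj.
have tu i : u' < t i < v'.
  rewrite ltrDl mulr_gt0 ?ltr0n //= -ltrBrDl -wE ltr_pM2r // ltr_nat ltnS.
  exact: ltn_ord.
have tab i : a <= t i <= b.
  by have /andP[h1 h2] := tu i; rewrite (le_trans au) ?(le_trans _ vb) //; lra.
have := fq t ti tab.
have -> : divided_difference f t = divided_difference (horner p) t.
  apply: eq_bigr => i _; rewrite fp //.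
  have /andP[h1 h2] := tu i; lra.
have tu' i : u' <= t i <= v' by have /andP[h1 h2] := tu i; rewrite !ltW.
have dp i : (i < q)%N -> forall y : R,
    is_derive y (1 : R) (horner p^`(i)) (p^`(i.+1)).[y].
  by move=> _ y; rewrite derivnS; apply: is_derive_poly.
have [y yuv dd] := divided_difference_mean (g := fun i => horner p^`(i)) dp ti tu'.
have py : p^`(q).[y] < 0.
  by apply: neg; clear -yuv ux vx e1; rewrite ltr_norml; lra.
by rewrite leNgt -(pmulr_llt0 _ (x := q`!%:R)) ?ltr0n ?fact_gt0 // dd py.
Qed.

End DividedDifferences.

(** * Derivatives of truncated powers and matching of polynomial pieces *)

Section Smoothness.
Variable R : realType.

Lemma tpow_continuous (t : R) k : continuous (tpow t k.+1).
Proof.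
have -> : tpow t k.+1 = (fun x : R => ((x - t + `|x - t|) / 2) ^+ k.+1).
  apply/funext => x; rewrite /tpow; case: (lerP t x) => tx.
    by congr (_ ^+ _); lra.
  by rewrite (_ : x - t + (t - x) = 0) ?mul0r ?expr0n //; lra.
move=> x; apply: (@cvg_comp _ _ _ _ (fun y : R =>
  y ^+ k.+1) _ _ _ _ (@exprn_continuous R _ _)).
apply: cvgM; last exact: cvg_cst.
have h : (y - t) @[y --> x] --> x - t by apply: cvgB; [exact: cvg_id|exact: cvg_cst].
by apply: cvgD => //; apply: cvg_norm.
Qed.

(** At the knot the Caratheodory slope function is the truncated power of one degree less; its
    exponent is still positive, so it is continuous and vanishes there. *)
Lemma is_derive_tpow (t : R) k (x : R) :
  is_derive x (1 : R) (tpow t k.+2) (k.+2%:R * tpow t k.+1 x).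
Proof.
have dX : is_derive x (1 : R) (fun y : R =>
  (y - t) ^+ k.+2) (k.+2%:R * (x - t) ^+ k.+1).
  have := is_derive_poly (('X - t%:P) ^+ k.+2) x.
  rewrite deriv_exp derivXsubC mul1r hornerMn !hornerE /= mulr_natl.
  by congr is_derive; apply/funext => y; rewrite !hornerE.
case: (ltgtP t x) => [tx|xt|<-].
- rewrite [tpow t k.+1 x]tpow_right ?ltW //; apply: near_eq_is_derive dX.
  near=> y; rewrite tpow_right // ltW //; near: y; exact: lt_nbhsr.
- rewrite tpow_left // mulr0.
  apply: near_eq_is_derive (is_derive_cst (0 : R) x (1 : R)).
  near=> y; rewrite tpow_left //; near: y; exact: lt_nbhsl.
- rewrite tpow_right // subrr expr0n mulr0; apply/is_derive1_caratheodory.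
  exists (tpow t k.+1); split.
  + by move=> z; rewrite [tpow t _ t]tpow_right // subrr expr0n subr0 tpowS mulrC.
  + exact: tpow_continuous.
  + by rewrite tpow_right // subrr expr0n.
Unshelve. all: by end_near.
Qed.

Lemma is_derive_quotient (f : R -> R) (x d : R) (D : set R) :
  is_derive x (1 : R) f d ->
  (f y - f x) / (y - x) @[y --> within D x^'] --> d.
Proof.
move=> /is_derive1_caratheodory[g [fE gx <-]].
have h : g y @[y --> within D x^'] --> g x.
  by apply: cvg_within_filter; apply: cvg_within_filter.
apply: cvg_trans h; apply: near_eq_cvg.
rewrite !near_withinE; near=> y => yx _.
by rewrite fE mulfK // subr_eq0.
Unshelve. all: by end_near.
Qed.

Lemma Ck_is_derive (k : nat) (g : nat -> R -> R) (a b : R) :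
  (forall i, (i < k)%N -> forall y : R, is_derive y (1 : R) (g i) (g i.+1 y)) ->
  continuous (g k) -> Ck k a b (g 0%N).
Proof.
elim: k g => [|k IH] g dg ck; first exact: continuous_subspaceT.
exists (g 1%N); last by apply: (IH (fun i => g i.+1)) => // i ik y; apply: dg.
by move=> x _; apply: is_derive_quotient; apply: dg.
Qed.

Lemma derivative_on_continuous (a b : R) (f g : R -> R) :
  derivative_on a b f g -> {within `[a, b], continuous f}.
Proof.
move=> fg; apply/subspace_continuousP => x; rewrite /= in_itv /= => xab.
apply/cvgrPdist_le => e e0.
have /cvgrPdist_le /(_ 1 ltr01) := fg x xab.
rewrite !near_withinE => h.
pose M := `|g x| + 1.
have M0 : 0 < M by rewrite ltr_wpDl.
near=> y => yab.
have hy : `|x - y| <= e / M.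
  near: y; apply/nbhs_ballP; exists (e / M) => /=; first exact: divr_gt0.
  by move=> z /= /ltW.
case: (eqVneq y x) => [->|yx]; first by rewrite subrr normr0 ltW.
have q1 : `|(f y - f x) / (y - x)| <= M.
  have : `|g x - (f y - f x) / (y - x)| <= 1.
    by apply: (near h y) => //.
  set u := _ / _ => hu; rewrite -(subKr (g x) u) (le_trans (ler_normB _ _)) //.
  by rewrite lerD2l.
have -> : f x - f y = - ((f y - f x) / (y - x) * (y - x)).
  by rewrite divfK ?subr_eq0 // opprB.
rewrite normrN normrM -[leRHS](divfK (lt0r_neq0 M0)) mulrC.
by rewrite ler_pM // distrC.
Unshelve. all: by end_near.
Qed.

Lemma Ck_continuous k (a b : R) (f : R -> R) :
  Ck k a b f -> {within `[a, b], continuous f}.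
Proof. by case: k => [//|k] [g fg _]; apply: derivative_on_continuous fg. Qed.

(** Piecewise polynomials have free values at the knots; one-sided limits recover these values from
    continuity. *)
Lemma poly_at_ends (a b u v : R) (f : R -> R) (p : {poly R}) :
  {within `[a, b], continuous f} -> a <= u -> u < v -> v <= b ->
  (forall x, u < x < v -> f x = p.[x]) -> f u = p.[u] /\ f v = p.[v].
Proof.
move=> cf au uv vb fp.
have : {within `[u, v], continuous f}.
  apply: continuous_subspaceW cf; apply: subset_itv; rewrite bnd_simp //.
move=> /(continuous_within_itvP _ uv)[_ cu cv]; split.
- have h : p.[x] @[x --> u^'+] --> p.[u].
    by apply: cvg_at_right_filter; apply: continuous_horner.
  apply: (@cvg_unique _ (@Rhausdorff R) (f x @[x --> u^'+])) => //.
  apply: cvg_trans h; apply: near_eq_cvg; near=> x; apply/esym/fp.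
  by apply/andP; split.
- have h : p.[x] @[x --> v^'-] --> p.[v].
    by apply: cvg_at_left_filter; apply: continuous_horner.
  apply: (@cvg_unique _ (@Rhausdorff R) (f x @[x --> v^'-])) => //.
  apply: cvg_trans h; apply: near_eq_cvg; near=> x; apply/esym/fp.
  by apply/andP; split.
Unshelve. all: by end_near.
Qed.

(** Right neighbourhoods of [x] refine its punctured neighbourhoods relative to [[a, b]], so the
    limit of difference quotients may be taken from the right, where [f] is still the polynomial. *)
Lemma derivative_on_poly (a b u v : R) (f g : R -> R) (p : {poly R}) :
  derivative_on a b f g -> a <= u -> v <= b ->
  (forall x, u < x < v -> f x = p.[x]) ->
  forall x, u < x < v -> g x = p^`().[x].
Proof.
move=> fg au vb fp x /andP[ux xv].
have xab : a <= x <= b by rewrite (le_trans au) ?(le_trans _ vb) // ltW.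
have sub : x^'+ --> within `[a, b] x^'.
  move=> P h; have {}h : \forall y \near x, y != x -> `[a, b]%classic y -> P y
    by exact: h.
  suff : \forall y \near x^'+, P y by [].
  near=> y; have xy : x < y by near: y; apply: nbhs_right_gt.
  have : y != x -> `[a, b]%classic y -> P y.
    by near: y; apply: cvg_within h.
  apply; first by rewrite gt_eqF.
  rewrite /= in_itv /= (le_trans (proj1 (andP xab)) (ltW xy)) /=.
  by rewrite (le_trans _ vb) // ltW //; near: y; apply: nbhs_right_lt.
have h1 := cvg_trans (cvg_app (fun y => (f y - f x) / (y - x)) sub) (fg x xab).
have h2 := @is_derive_quotient (horner p) x _ setT (is_derive_poly p x).
have h3 : (f y - f x) / (y - x) @[y --> x^'+] --> p^`().[x].
  have sub2 : x^'+ --> within setT x^'.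
    move=> P h; have {}h : \forall y \near x, y != x -> setT y -> P y by exact: h.
    suff : \forall y \near x^'+, P y by [].
    near=> y; have xy : x < y by near: y; apply: nbhs_right_gt.
    have : y != x -> setT y -> P y by near: y; apply: cvg_within h.
    by apply; rewrite ?gt_eqF.
  apply: cvg_trans (cvg_trans (cvg_app _ sub2) h2); apply: near_eq_cvg.
  near=> y; rewrite !fp ?ux ?xv //.
  apply/andP; split; last by near: y; apply: nbhs_right_lt.
  by apply: (lt_trans ux); near: y; apply: nbhs_right_gt.
exact: (@cvg_unique _ (@Rhausdorff R) _ _ _ _ h1 h3).
Unshelve. all: by end_near.
Qed.

(** Differentiating on both sides of the knot reduces every order to continuity. With [k = q - 1] it
    makes the jump polynomial vanish to order [q]. *)
Lemma Ck_match (k : nat) (a b u c v : R) (f : R -> R) (p1 p2 : {poly R}) :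
  Ck k a b f -> a <= u -> u < c -> c < v -> v <= b ->
  (forall x, u < x < c -> f x = p1.[x]) ->
  (forall x, c < x < v -> f x = p2.[x]) ->
  forall i, (i <= k)%N -> p1^`(i).[c] = p2^`(i).[c].
Proof.
move=> + au uc cv vb; have ac : a <= c by rewrite (le_trans au) // ltW.
have cb : c <= b by rewrite (le_trans _ vb) // ltW.
elim: k f p1 p2 => [|k IH] f p1 p2 fk f1 f2 [|i] ik //.
- have [_ <-] := poly_at_ends (Ck_continuous fk) au uc cb f1.
  by have [] := poly_at_ends (Ck_continuous fk) ac cv vb f2.
- have [_ <-] := poly_at_ends (Ck_continuous fk) au uc cb f1.
  by have [] := poly_at_ends (Ck_continuous fk) ac cv vb f2.
- case: fk => g fg gk; rewrite /derivn !iterSr; apply: (IH g) => //.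
    exact: derivative_on_poly fg au cb f1.
  exact: derivative_on_poly fg ac vb f2.
Qed.

End Smoothness.

(** * Two-sided bounds for [L_p] norms on intervals *)

Section LpBounds.
Variable R : realType.
Local Notation mu := (@lebesgue_measure R).

(** The integral of a nonnegative function is a supremum over the simple functions below it, and a
    larger function admits more of them. This covers functions whose measurability has not been
    established. *)
Lemma ge0_integral_mono (f1 f2 : R -> \bar R) :
  (forall x, 0 <= f1 x)%E -> (forall x, f1 x <= f2 x)%E ->
  (\int[mu]_x f1 x <= \int[mu]_x f2 x)%E.
Proof.
move=> f10 f12; rewrite !ge0_integralTE //; last by move=> x; apply: le_trans (f12 x).
apply: le_ereal_sup => _ [h hf <-]; exists h => // x.
exact: le_trans (hf x) (f12 x).
Qed.

(** The [L_p] norm of the constant 1 on an interval of length [l]; the exponent [1/p] is read as 0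
    at infinity. *)
Definition len_pow (p : \bar R) (l : R) : R := if p is EFin r then l `^ r^-1 else 1.

Lemma len_pow_gt0 p l : 0 < l -> 0 < len_pow p l.
Proof. by case: p => [r| |] l0 //=; rewrite powR_gt0. Qed.

Lemma len_powM p l1 l2 : 0 <= l1 -> 0 <= l2 ->
  len_pow p (l1 * l2) = len_pow p l1 * len_pow p l2.
Proof. by case: p => [r| |] h1 h2 /=; rewrite ?mulr1 // powRM. Qed.

Lemma len_pow_le p l1 l2 : (0 < p)%E -> 0 <= l1 -> l1 <= l2 ->
  len_pow p l1 <= len_pow p l2.
Proof.
case: p => [r| |] //= r0 h1 h2; rewrite lte_fin in r0.
by apply: ge0_ler_powR; rewrite ?invr_ge0 ?nnegrE ?(le_trans h1 h2) // ltW.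
Qed.

Lemma integral_cst_itv (a b c : R) : a <= b -> 0 <= c ->
  (\int[mu]_x ((cst c%:E \_ `[a, b]) x) = (c * (b - a))%:E)%E.
Proof.
move=> ab c0; rewrite -integral_mkcond integral_cst //=.
rewrite lebesgue_measure_itv /= lte_fin; case: ltP => h //.
have -> : a = b by apply/eqP; rewrite eq_le ab h.
by rewrite subrr mule0 mulr0.
Qed.

Lemma Lp_norm_le p (a b M : R) (f : R -> R) : (0 < p)%E -> a <= b -> 0 <= M ->
  (forall x, a <= x <= b -> `|f x| <= M) ->
  (Lp_norm p `[a, b] f <= (M * len_pow p (b - a))%:E)%E.
Proof.
move=> p0 ab M0 fM; rewrite /Lp_norm unlock; case: p p0 => [r| |] //= r0.
- rewrite lte_fin in r0; have rV : 0 <= r^-1 by rewrite invr_ge0 ltW.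
  have -> : (M * (b - a) `^ r^-1)%:E = (((M `^ r * (b - a))%:E) `^ r^-1)%E.
    rewrite poweR_EFin powRM ?powR_ge0 ?subr_ge0 // -powRrM mulfV ?gt_eqF //.
    by rewrite powRr1.
  apply: gt0_ler_poweR => //.
  + by rewrite in_itv /= leey andbT; apply: integral_ge0.
  + by rewrite in_itv /= leey andbT lee_fin mulr_ge0 ?powR_ge0 ?subr_ge0.
  rewrite -integral_cst_itv ?powR_ge0 //; apply: ge0_integral_mono => // x.
  rewrite /= !patchE; case: ifPn => [|_].
    rewrite inE /= in_itv /= => /fM h.
    by rewrite lee_fin; apply: ge0_ler_powR; rewrite ?nnegrE // ltW.
  by rewrite normr0 powR0 // gt_eqF.
- rewrite mulr1; case: ifP => _; last by rewrite lee_fin.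
  apply/ess_supP; apply: nearW => x /=; rewrite patchE lee_fin.
  by case: ifPn => [|_]; [rewrite inE /= in_itv /= => /fM|rewrite normr0].
Qed.

(** For infinite [p], an essential bound below [m] would make [[u, v]] negligible, although its
    length is positive. *)
Lemma Lp_norm_ge p (a b u v m : R) (f : R -> R) : (0 < p)%E -> 0 <= m ->
  a <= u -> u < v -> v <= b -> (forall x, u <= x <= v -> m <= `|f x|) ->
  ((m * len_pow p (v - u))%:E <= Lp_norm p `[a, b] f)%E.
Proof.
move=> p0 m0 au uv vb fm.
have sub x : u <= x <= v -> x \in `[a, b]%classic.
  by move=> /andP[h1 h2]; rewrite inE /= in_itv /= (le_trans au h1) (le_trans h2 vb).
rewrite /Lp_norm unlock; case: p p0 => [r| |] //= r0.
- rewrite lte_fin in r0; have rV : 0 <= r^-1 by rewrite invr_ge0 ltW.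
  have -> : (m * (v - u) `^ r^-1)%:E = (((m `^ r * (v - u))%:E) `^ r^-1)%E.
    rewrite poweR_EFin powRM ?powR_ge0 ?subr_ge0 ?(ltW uv) // -powRrM mulfV ?gt_eqF //.
    by rewrite powRr1.
  apply: gt0_ler_poweR => //.
  + by rewrite in_itv /= leey andbT lee_fin mulr_ge0 ?powR_ge0 ?subr_ge0 // ltW.
  + by rewrite in_itv /= leey andbT; apply: integral_ge0.
  rewrite -integral_cst_itv ?powR_ge0 ?(ltW uv) //; apply: ge0_integral_mono => x.
    by rewrite patchE; case: ifP => // _; rewrite lee_fin powR_ge0.
  rewrite /= !patchE; case: ifPn => xuv; last first.
    (* Outside [[u, v]] the restricted constant takes the default point of the extended reals, which
       is 0. *)
    by rewrite -[point]/(0%R%:E) lee_fin powR_ge0.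
  have {}xuv : u <= x <= v by move: xuv; rewrite inE /= in_itv.
  rewrite (sub x xuv) lee_fin; apply: ge0_ler_powR; rewrite ?nnegrE ?(ltW r0) //.
  exact: fm.
have uv0 : (0 < mu `[u, v])%E.
  by rewrite lebesgue_measure_itv /= lte_fin uv lte_fin subr_gt0.
rewrite mulr1; case: ifPn => [_|/negP []]; last first.
  by apply: lt_le_trans uv0 _; apply: le_measure; rewrite ?inE //;
    apply: measurable_itv.
rewrite leNgt; apply/negP => h.
have [y hy ym] : exists2 y, (\forall x \ae mu, ((abse \o (EFin \o f \_ `[a,
  b])) x <= y)%E) & (y < m%:E)%E.
  by have /ereal_inf_lt[y hy1 hy2] := h; exists y.
have : mu.-negligible `[u, v]%classic.
  apply: negligibleS hy => x; rewrite /= in_itv /= => xuv; apply/negP.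
  rewrite -ltNge (lt_le_trans ym) // patchE (sub x xuv) lee_fin.
  exact: fm.
move=> hn; have e0 : mu `[u, v] = 0%E.
  by apply: (measure_negligible (mu := mu)) => //; apply: measurable_itv.
by move: uv0; rewrite e0 ltxx.
Qed.

End LpBounds.

(** * Geometry of uniform and Chebyshev knots *)

Section Knots.
Variable R : realType.
Implicit Types (x y : R).

Lemma sin_MVT x y : x <= y -> exists2 c, x <= c <= y & sin y - sin x = cos c * (y - x).
Proof.
move=> xy; have [|c cI h] := @MVT_segment R sin cos x y xy (fun c _ => is_derive_sin c).
  by apply: continuous_subspaceT => z; apply: continuous_sin.
by exists c => //; move: cI; rewrite in_itv.
Qed.

Lemma sin_le_id x : 0 <= x -> sin x <= x.
Proof.
move=> x0; have [c _] := sin_MVT x0; rewrite sin0 !subr0 => ->.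
by rewrite ler_piMl // cos_le1.
Qed.

Lemma norm_sin_le x : `|sin x| <= `|x|.
Proof.
wlog x0 : x / 0 <= x.
  by move=> H; case: (lerP 0 x) => [/H //|x0];
    rewrite -normrN -sinN -[leRHS]normrN H ?oppr_ge0 ?ltW.
have [c _] := sin_MVT x0; rewrite sin0 !subr0 => ->.
by rewrite normrM ler_piMl // cos_max.
Qed.

Lemma norm_sinD_le x y : `|sin (x + y)| <= `|sin x| + `|sin y|.
Proof.
rewrite sinD (le_trans (ler_normD _ _)) // !normrM.
by apply: lerD; [rewrite ler_piMr // cos_max|rewrite ler_piMl // cos_max].
Qed.

(** On [[0, 1]] the derivative is at least [1/2], because [cos c = 1 - 2 sin(c/2)^2] and
    [sin(c/2) <= 1/2]. *)
Lemma sin_ge_half x : 0 <= x <= 1 -> x / 2 <= sin x.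
Proof.
move=> /andP[x0 x1]; have [c /andP[c0 cx]] := sin_MVT x0; rewrite sin0 !subr0 => ->.
rewrite mulrC ler_wpM2r //.
have -> : c = (c / 2) *+ 2 by rewrite -mulr_natr divfK ?pnatr_eq0.
rewrite cos_mulr2n cos2sin2.
have h : `|sin (c / 2)| <= `|c / 2| := norm_sin_le _.
have h1 : `|sin (c / 2)| <= 1 / 2.
  by apply: le_trans h _; rewrite ger0_norm ?divr_ge0 //; lra.
have h2 : sin (c / 2) ^+ 2 <= (1 / 2) ^+ 2.
  by rewrite -real_normK ?num_real // lerXn2r // nnegrE.
have e : (1 / 2) ^+ 2 = 1 / 4 :> R by field.
rewrite e in h2; move: (sin (c / 2) ^+ 2) h2 => S hS; clear -hS; lra.
Qed.

Lemma sin_ge_sin x y : 0 <= x -> x <= y -> y <= pi - x -> sin x <= sin y.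
Proof.
move=> x0 xy yx; have p0 := @pi_gt0 R.
wlog yp : y xy yx / y <= pi / 2.
  move=> H; case: (lerP y (pi / 2)) => [h|h]; first exact: H.
  have -> : sin y = sin (pi - y) by rewrite sinB sinpi cospi mul0r sub0r mulN1r opprK.
  by apply: H; lra.
move: xy; rewrite le_eqVlt => /orP[/eqP -> //|xy].
by apply/ltW; rewrite ltr_sin ?in_itv //=; apply/andP; split; lra.
Qed.

Lemma cosB_prod x y : cos x - cos y = 2 * sin ((x + y) / 2) * sin ((y - x) / 2).
Proof.
have -> : cos x = cos ((x + y) / 2 - (y - x) / 2) by congr cos; lra.
have -> : cos y = cos ((x + y) / 2 + (y - x) / 2) by congr cos; lra.
by rewrite cosB cosD; ring.
Qed.

Definition angle (n j : nat) : R := j%:R * pi / n%:R.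

Lemma angle_bounds n j : (j <= n)%N -> (0 < n)%N -> 0 <= angle n j <= pi.
Proof.
move=> jn n0; rewrite /angle; have p0 := @pi_ge0 R.
rewrite divr_ge0 ?mulr_ge0 ?ler0n //= ler_pdivrMr ?ltr0n //.
by rewrite mulrC ler_wpM2l // ler_nat.
Qed.

Lemma angle_lt n i j : (i < j)%N -> (0 < n)%N -> angle n i < angle n j.
Proof.
move=> ij n0; rewrite /angle ltr_pM2r ?invr_gt0 ?ltr0n //.
by rewrite ltr_pM2r ?pi_gt0 // ltr_nat.
Qed.

Lemma angleS n j : angle n j.+1 = angle n j + pi / n%:R.
Proof. by rewrite /angle -natr1 2!mulrDl mul1r. Qed.

Lemma anglen n : (0 < n)%N -> angle n n = pi.
Proof. by move=> n0; rewrite /angle mulrAC divff ?mul1r // pnatr_eq0 -lt0n. Qed.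

Lemma knot0 K n : knot R K n 0 = -1.
Proof.
case: K; rewrite /knot; first by rewrite mulr0 mul0r addr0.
by rewrite !mul0r cos0.
Qed.

Lemma knotn K n : (0 < n)%N -> knot R K n n = 1.
Proof.
move=> n0; have nn : n%:R != 0 :> R by rewrite pnatr_eq0 -lt0n.
case: K; rewrite /knot; first by rewrite mulfK //; ring.
by rewrite -/(angle n n) anglen // cospi opprK.
Qed.

Lemma knot_lt K n i j : (i < j)%N -> (j <= n)%N -> knot R K n i < knot R K n j.
Proof.
move=> ij jn; have n0 : (0 < n)%N by apply: leq_trans jn; apply: leq_trans ij.
case: K; rewrite /knot.
  by rewrite ltrD2l ltr_pM2r ?invr_gt0 ?ltr0n // ltr_pM2l // ltr_nat.
rewrite ltrN2 -/(angle n i) -/(angle n j) ltr_cos ?in_itv ?angle_bounds //.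
  exact: angle_lt.
by apply: leq_trans jn; apply: ltnW.
Qed.

Lemma knot_le K n i j : (i <= j)%N -> (j <= n)%N -> knot R K n i <= knot R K n j.
Proof.
rewrite leq_eqVlt => /orP[/eqP -> //|ij jn]; exact/ltW/knot_lt.
Qed.

Lemma bracket (f : nat -> R) m x : f 0%N <= x -> x <= f m -> (0 < m)%N ->
  exists2 i, (i < m)%N & f i <= x <= f i.+1.
Proof.
move=> f0; elim: m => // m IH fm _.
case: (posnP m) => [m0|m0]; first by exists 0%N => //; rewrite f0; rewrite m0 in fm.
case: (lerP x (f m)) => h.
  by have [i im fi] := IH h m0; exists i => //; apply: leqW.
by exists m => //; rewrite fm ltW.
Qed.

(** [H] is a local mesh size. For Chebyshev knots put [z_j = - cos theta] and [a = pi/n]: the gaps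
    next to [z_j] are [2 sin(theta - a/2) sin(a/2)] and [2 sin(theta + a/2) sin(a/2)]. An interior
    [theta] lies in [[a, pi - a]], so both shifted sines are within a factor 2 of [sin theta], which
    suggests [H = sin theta sin(a/2)]. *)
Lemma knot_local_geometry (k : R) : 0 < k -> exists m0 : nat, (0 < m0)%N /\
  forall K n j, (0 < j)%N -> (j < n)%N -> exists H : R, [/\ 0 < H,
    H <= knot R K n j - knot R K n j.-1 <= 4 * H,
    H <= knot R K n j.+1 - knot R K n j <= 4 * H &
    forall m x, (m0 * n <= m)%N -> `|x - knot R K n j| <= H / 4 ->
      exists2 i, (i <= m)%N & `|knot R K m i - x| <= k * H].
Proof.
move=> k0.
(* The Chebyshev case needs 28, the product of 7, from comparing sines at nearby angles, and 4, from
   [a / 4 <= sin (a / 2)]. *)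
pose m0 := (Num.truncn (28 / k)).+1.
have m0k : 28 <= k * m0%:R.
  by rewrite -ler_pdivrMl // mulrC ltW // truncnS_gt.
exists m0; split=> // K n j j0 jn.
have n0 : (0 < n)%N by apply: leq_trans jn.
have nR : 0 < n%:R :> R by rewrite ltr0n.
have [j' ej] : exists j', j = j'.+1 by exists j.-1; rewrite prednK.
(* Density follows from a bound on the gaps of [z_m] that meet [[z_(j-1), z_(j+1)]], since [x] lies
   in one of them. *)
suff [H [H0 gl gr gap]] : exists H : R, [/\ 0 < H,
    H <= knot R K n j - knot R K n j.-1 <= 4 * H,
    H <= knot R K n j.+1 - knot R K n j <= 4 * H &
    forall m i, (m0 * n <= m)%N -> (i < m)%N ->
      knot R K m i <= knot R K n j.+1 -> knot R K n j.-1 <= knot R K m i.+1 ->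
      knot R K m i.+1 - knot R K m i <= k * H].
  exists H; split=> // m x mn; rewrite ler_norml => /andP[x1 x2].
  have m1 : (0 < m)%N by apply: leq_trans mn; rewrite muln_gt0.
  have zl : -1 <= knot R K n j.-1 by rewrite -(knot0 K n) knot_le // ej /= ltnW //
    ltnW // -ej.
  have zr : knot R K n j.+1 <= 1 by rewrite -(knotn K n0) knot_le.
  have [||i im /andP[i1 i2]] := @bracket (knot R K m) m x _ _ m1.
  - by rewrite knot0; clear -x1 zl gl H0; lra.
  - by rewrite knotn //; clear -x2 zr gr H0; lra.
  exists i; first exact: ltnW.
  have h1 : knot R K m i <= knot R K n j.+1 by clear -i1 x2 gr H0; lra.
  have h2 : knot R K n j.-1 <= knot R K m i.+1 by clear -i2 x1 gl H0; lra.
  have := gap m i mn im h1 h2.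
  by rewrite ler_norml; clear -i1 i2 k0 H0 => h; have := mulr_gt0 k0 H0; lra.
case: K.
  have step N i : (0 < N)%N -> knot R Defs.Uniform N i.+1 - knot R Defs.Uniform N i =
    2 / N%:R.
    by move=> N0; rewrite /knot -natr1; field; rewrite pnatr_eq0 -lt0n.
  exists (2 / n%:R); split; first by rewrite divr_gt0.
  - rewrite ej /= step // lexx /= ler_peMl ?ler1n // divr_ge0 //.
  - by rewrite step // lexx /= ler_peMl ?ler1n // divr_ge0.
  move=> m i mn im _ _; have m1 : (0 < m)%N by apply: leq_trans im.
  rewrite step // ler_pdivrMr ?ltr0n //.
  have h1 : m0%:R * n%:R <= m%:R :> R by rewrite -natrM ler_nat.
  have h2 : k * (2 / n%:R) * (m0%:R * n%:R) <= k * (2 / n%:R) * m%:R.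
    by rewrite ler_pM2l // mulr_gt0 // divr_gt0.
  have h3 : k * (2 / n%:R) * (m0%:R * n%:R) = 2 * (k * m0%:R) by field; rewrite gt_eqF.
  by clear -m0k h2 h3; lra.
pose a : R := pi / n%:R; pose th := angle n j.
have p0 := @pi_gt0 R; have a0 : 0 < a by rewrite divr_gt0.
have n2 : (2 <= n)%N by apply: leq_ltn_trans jn.
have a2 : a / 2 <= 1.
  have h1 : a <= pi / 2 by rewrite ler_pM2l // lef_pV2 ?posrE // ler_nat.
  by have := @pihalf_lt2 R; clear -h1; lra.
have tha : a <= th <= pi - a.
  have /andP[_] := angle_bounds jn n0; rewrite angleS -/th -/a => h1.
  have h2 : a <= th.
    have -> : a = angle n 1 by rewrite /angle mul1r.
    by rewrite /th /angle ler_pM2r ?invr_gt0 // ler_pM2r // ler_nat.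
  by clear -h1 h2; lra.
have a2' : 0 <= a / 2 <= 1 by rewrite a2 divr_ge0 ?(ltW a0).
have sa0 : 0 < sin (a / 2).
  by apply: lt_le_trans (sin_ge_half a2'); clear -a0; lra.
have sha : a / 4 <= sin (a / 2).
  apply: le_trans (sin_ge_half a2').
  by clear -a0; lra.
have big y : a / 2 <= y -> y <= pi - a / 2 -> sin (a / 2) <= sin y.
  by move=> h1 h2; apply: sin_ge_sin => //; case/andP: a2'.
have [s1 s2 s3] : [/\ sin (a / 2) <= sin th, sin (a / 2) <= sin (th + a / 2) &
    sin (a / 2) <= sin (th - a / 2)].
  by split; apply: big; clear -tha a0; lra.
have sth : 0 < sin th by apply: lt_le_trans s1.
have sD x y : 0 <= sin y -> sin (x + y) <= `|sin x| + sin y.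
  by move=> y0; rewrite -(ger0_norm y0) (le_trans (ler_norm _)) //
    (le_trans (norm_sinD_le _ _)) // ger0_norm.
have sDa x : 0 <= sin x -> sin (x + a / 2) <= sin x + sin (a / 2).
  by move=> x0; have := @sD x (a / 2) (ltW sa0); rewrite ger0_norm.
have sBa x : 0 <= sin x -> sin (x - a / 2) <= sin x + sin (a / 2).
  move=> x0; have := @sD (- (a / 2)) x x0.
  by rewrite sinN normrN (ger0_norm (ltW sa0)) [- (a / 2) + x]addrC [_ + sin x]addrC.
have u1 : sin (th + a / 2) <= 2 * sin th by have := sDa th (ltW sth); clear -s1; lra.
have u2 : sin (th - a / 2) <= 2 * sin th by have := sBa th (ltW sth); clear -s1; lra.
have l1 : sin th <= 2 * sin (th + a / 2).
  have := sBa (th + a / 2) (le_trans (ltW sa0) s2); rewrite addrK; clear -s2; lra.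
have l2 : sin th <= 2 * sin (th - a / 2).
  have := sDa (th - a / 2) (le_trans (ltW sa0) s3); rewrite subrK; clear -s3; lra.
have gapE N i : knot R Chebyshev N i.+1 - knot R Chebyshev N i =
    2 * sin (angle N i + pi / N%:R / 2) * sin (pi / N%:R / 2).
  rewrite /knot opprK addrC -/(angle N i) -/(angle N i.+1) cosB_prod angleS.
  by congr (2 * sin _ * sin _); lra.
have thE : angle n j.-1 = th - a by rewrite /th ej /= angleS addrK.
exists (sin th * sin (a / 2)); split; first exact: mulr_gt0.
- have -> : knot R Chebyshev n j - knot R Chebyshev n j.-1 = 2 * sin (th - a / 2) *
  sin (a / 2).
    have ej' : j' = j.-1 by rewrite ej.
    have := gapE n j'; rewrite -ej ej' thE -/a => ->; congr (2 * sin _ * _).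
    by clear; lra.
  by rewrite mulrA !ler_pM2r // l2 /=; clear -u2; lra.
- rewrite gapE -/a -/th mulrA !ler_pM2r // l1 /=; clear -u1; lra.
move=> m i mn im h1 h2; have m1 : (0 < m)%N by apply: leq_trans im.
rewrite gapE; set b := pi / m%:R; set ph := angle m i + b / 2.
have b0 : 0 < b by rewrite divr_gt0 // ltr0n.
have bm : m0%:R * b <= a.
  rewrite /b mulrCA /a ler_pM2l // ler_pdivrMr ?ltr0n // mulrC ler_pdivlMr //.
  by rewrite -natrM ler_nat.
have ba : b <= a.
  by apply: le_trans bm; rewrite ler_peMl ?ler1n // ltW.
have t1 : angle m i <= th + a.
  rewrite leNgt -angleS; apply/negP => h.
  have : knot R Chebyshev n j.+1 < knot R Chebyshev m i.
    by rewrite /knot ltrN2 ltr_cos ?in_itv ?angle_bounds // ltnW.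
  by rewrite ltNge h1.
have t2 : th - a <= angle m i.+1.
  rewrite leNgt -thE; apply/negP => h.
  have : knot R Chebyshev m i.+1 < knot R Chebyshev n j.-1.
    rewrite /knot ltrN2 ltr_cos ?in_itv ?angle_bounds // ej /=.
    by rewrite ltnW // ltnW // -ej.
  by rewrite ltNge h2.
(* The midpoint angle [ph] is within [3a/2] of [th], and [a/4 <= sin(a/2) <= sin th] turns this
   distance into at most [6 sin th]. *)
have hph : sin ph <= 7 * sin th.
  have e : ph = (ph - th) + th by rewrite subrK.
  have h3 : sin ph <= `|sin (ph - th)| + sin th by rewrite [in leLHS]e; apply: sD;
    apply: ltW.
  have h4 : `|ph - th| <= 3 * a / 2.
    rewrite ler_norml /ph; rewrite angleS -/b in t2; clear -t1 t2 ba b0; lra.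
  have := norm_sin_le (ph - th); clear -h3 h4 sha s1; lra.
have hb : sin (b / 2) <= b / 2 by apply: sin_le_id; rewrite divr_ge0 // ltW.
have hb2 : m0%:R * (b / 2) <= 2 * sin (a / 2) by rewrite mulrA; clear -bm sha; lra.
have hb3 : 28 * (b / 2) <= k * (2 * sin (a / 2)).
  apply: le_trans (_ : k * (m0%:R * (b / 2)) <= _); last by rewrite ler_pM2l.
  by rewrite [k * _]mulrA ler_pM2r // divr_gt0.
apply: le_trans (_ : 2 * (7 * sin th) * (b / 2) <= _).
  have sb0 : 0 <= sin (b / 2).
    have b2 : 0 <= b / 2 <= 1 by clear -ba a2 b0; lra.
    by apply: le_trans (sin_ge_half b2); clear -b0; lra.
  apply: le_trans (_ : 2 * (7 * sin th) * sin (b / 2) <= _).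
    by rewrite ler_wpM2r // ler_pM2l.
  by rewrite ler_pM2l // !mulr_gt0.
have -> : k * (sin th * sin (a / 2)) = sin th * (k * (2 * sin (a / 2))) / 2 by field.
have -> : 2 * (7 * sin th) * (b / 2) = sin th * (28 * (b / 2)) / 2 by field.
by rewrite ler_pM2r ?invr_gt0 // ler_pM2l.
Qed.

End Knots.

(** * Transport of the model problem to an arbitrary knot *)

Section KnotSmoothing.
Variable R : realType.
Implicit Types (p P F : {poly R}) (x y z H : R) (L : seq (R * R)).

Definition rescale z H p : {poly R} := p \Po (z%:P + H *: 'X).

Lemma rescale_horner z H p y : (rescale z H p).[y] = p.[z + H * y].
Proof. by rewrite horner_comp !hornerE. Qed.

Lemma size_rescale z H p : H != 0 -> size (rescale z H p) = size p.
Proof.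
move=> H0; rewrite size_comp_poly2 // addrC size_polyDl size_scale ?size_polyX //.
by rewrite ltnS size_polyC_leq1.
Qed.

Lemma derivn_rescale z H p k : (rescale z H p)^`(k) = H ^+ k *: rescale z H p^`(k).
Proof.
elim: k => [|k IH]; first by rewrite expr0 scale1r.
rewrite derivnS IH derivZ /rescale deriv_comp derivD derivC add0r derivZ derivX.
by rewrite alg_polyC mulrC mul_polyC scalerA -exprSr -derivnS.
Qed.

Lemma rescale_coef0 z H p q : (forall i, (i < q)%N -> p^`(i).[z] = 0) ->
  forall i, (i < q)%N -> (rescale z H p)`_i = 0.
Proof.
move=> h i iq; have := coef_derivn i (rescale z H p) 0.
rewrite derivn_rescale coefZ -horner_coef0 rescale_horner mulr0 addr0 h // mulr0.
rewrite addn0 ffactnn => /esym/eqP; rewrite mulrn_eq0 => /orP[|/eqP //].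
by rewrite eqn0Ngt fact_gt0.
Qed.

(** The factor [H^-d] makes the sum of degree [d] at [z + H y] equal to the original sum at [y]. *)
Definition unscale (d : nat) z H L := [seq (e.1 / H ^+ d, z + H * e.2) | e <- L].

Lemma tsum_unscale d k z H L y : 0 < H ->
  tsum k (unscale d z H L) (z + H * y) = H ^+ k / H ^+ d * tsum k L y.
Proof.
move=> H0; rewrite /tsum big_map mulr_sumr; apply: eq_bigr => e _ /=.
rewrite /tpow lerD2l ler_pM2l //; case: ifP => _; last by rewrite !mulr0.
have -> : z + H * y - (z + H * e.2) = H * (y - e.2) by ring.
by rewrite exprMn; ring.
Qed.

Lemma psum_unscale d z H L y : 0 < H ->
  (psum d (unscale d z H L)).[z + H * y] = (psum d L).[y].
Proof.
move=> H0; rewrite !psum_horner big_map; apply: eq_bigr => e _ /=.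
have -> : z + H * y - (z + H * e.2) = H * (y - e.2) by ring.
rewrite exprMn mulrA divfK // expf_neq0 // gt_eqF //.
Qed.

(** Sizes are measured by the coefficients of the rescaled jump, so that [k] and [C] depend neither
    on [z] nor on [H]. *)
Lemma smoothing_at_knot q r : exists k C : R, [/\ 0 < k, 0 < C &
  forall (T : R -> Prop) z H, 0 < H ->
    (forall x, `|x - z| <= H / 4 -> exists2 t, T t & `|t - x| <= k * H) ->
  forall P1 P2 (a b : R), (size P1 <= (q + r).+1)%N -> (size P2 <= (q + r).+1)%N ->
    (forall i, (i < q)%N -> P1^`(i).[z] = P2^`(i).[z]) ->
    a + H <= z -> z + H <= b ->
    (forall x, a <= x <= z -> 0 <= P1^`(q).[x]) ->
    (forall x, z <= x <= b -> 0 <= P2^`(q).[x]) ->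
  exists L, [/\ forall e, e \in L -> T e.2 /\ `|e.2 - z| <= H / 4,
    psum (q + r) L = P2 - P1,
    forall x, `|(if z <= x then (P2 - P1).[x] else 0) - tsum (q + r) L x|
      <= C * cnorm (rescale z H (P2 - P1)) &
    forall x, a <= x <= b ->
      0 <= P1^`(q).[x] + ((q + r) ^_ q)%:R * tsum r L x]].
Proof.
have [k [C [k0 C0 loc]]] := local_smoothing R q r.
exists k, (1 + C); split=> //; first by rewrite addr_gt0.
move=> T z H H0 dT P1 P2 a b s1 s2 match12 az zb pos1 pos2.
have Hn : H != 0 by rewrite gt_eqF.
have toy x : x = z + H * ((x - z) / H) by rewrite mulrC divfK // subrKC.
set F := P2 - P1; set F' := rescale z H F.
have sF : (size F' <= (q + r).+1)%N.
  by rewrite size_rescale // (leq_trans (size_polyD _ _)) // size_polyN geq_max s2.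
have F0 : forall i, (i < q)%N -> F'`_i = 0.
  by apply: rescale_coef0 => i iq; rewrite derivnB hornerD hornerN match12 // subrr.
have [||||||L [LT Lp Lc Lpos]] := loc (fun y => T (z + H * y)) _ (rescale z H P1) F'
  ((z - a) / H) ((b - z) / H) _ sF F0.
- move=> y y1; have [|t Tt tx] := dT (z + H * y).
    by rewrite addrC addKr normrM gtr0_norm // ler_pM2l //; lra.
  exists ((t - z) / H); first by rewrite -toy.
  rewrite -(ler_pM2r H0) -{2}(gtr0_norm H0) -normrM mulrBl divfK //.
  by rewrite [y * H]mulrC -addrA -opprD.
- by rewrite size_rescale.
- by rewrite ler_pdivlMr // mul1r; lra.
- by rewrite ler_pdivlMr // mul1r; lra.
- move=> y /andP[y1 y2]; rewrite derivn_rescale hornerZ rescale_horner.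
  apply: mulr_ge0; first by rewrite exprn_ge0 // ltW.
  apply: pos1.
  have : H * (- ((z - a) / H)) <= H * y by rewrite ler_pM2l.
  have : H * y <= H * 0 by rewrite ler_pM2l.
  have e : H * ((z - a) / H) = z - a by rewrite mulrC divfK.
  by rewrite mulr0 mulrN e; clear; lra.
- move=> y /andP[y1 y2].
  have -> : rescale z H P1 + F' = rescale z H P2.
    by rewrite /F' /rescale -comp_polyD subrKC.
  rewrite derivn_rescale hornerZ rescale_horner.
  apply: mulr_ge0; first by rewrite exprn_ge0 // ltW.
  apply: pos2.
  have : H * y <= H * ((b - z) / H) by rewrite ler_pM2l.
  have : H * 0 <= H * y by rewrite ler_pM2l.
  have e : H * ((b - z) / H) = b - z by rewrite mulrC divfK.
  by rewrite mulr0 e; clear; lra.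
exists (unscale (q + r) z H L); split.
- move=> _ /mapP[e /LT[Te e1] ->] /=; split=> //.
  by rewrite addrC addKr normrM gtr0_norm // ler_pM2l //; lra.
- apply: poly_horner_inj => x; rewrite [x]toy psum_unscale // Lp rescale_horner //.
- move=> x; rewrite [in tsum _ _ _](toy x) tsum_unscale // divff ?expf_neq0 // mul1r.
  set y := (x - z) / H.
  have Fx : F.[x] = F'.[y] by rewrite rescale_horner -toy.
  have zx : (z <= x) = (0 <= y) by rewrite /y pmulr_lge0 ?invr_gt0 // subr_ge0.
  rewrite Fx zx; have cF := cnorm_ge0 F';
    have C1 : 0 <= C * cnorm F' by rewrite mulr_ge0 // ltW.
  (* Inside the window the jump and the list are bounded separately, which gives [1 + C]; outside it
     the two agree exactly. *)
  case: (lerP `|y| (1 / 4)) => y1.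
    apply: le_trans (ler_normB _ _) _; rewrite mulrDl mul1r lerD //.
      case: ifP => _; last by rewrite normr0.
      by apply: horner_le_cnorm; lra.
    have h : `|tsum (q + r) L y| <= cost L * 1 ^+ (q + r).
      apply: tsum_le => // e /LT[_]; move: y1; rewrite !ler_norml; clear => h1 h2; lra.
    by apply: le_trans h _; rewrite expr1n mulr1.
  suff -> : tsum (q + r) L y = if 0 <= y then F'.[y] else 0.
    by rewrite subrr normr0 mulr_ge0 // addr_ge0 // ltW.
  case: (lerP 0 y) => y0.
    rewrite tsum_right ?Lp // => e /LT[_]; move: y1; rewrite ger0_norm // ler_norml.
    by clear => h1 h2; lra.
  rewrite tsum_left // => e /LT[_]; move: y1; rewrite ltr0_norm // ler_norml.
  by clear => h1 h2; lra.
- move=> x /andP[ax xb]; set y := (x - z) / H.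
  have xy : x = z + H * y := toy x.
  have := Lpos y; rewrite derivn_rescale hornerZ rescale_horner -xy => hy.
  rewrite xy tsum_unscale // -xy.
  (* Multiplying the goal by [H^q] yields the model inequality: the list carries [H^-q], while
     differentiating the rescaled polynomial produces [H^q]. *)
  have -> : H ^+ r / H ^+ (q + r) = (H ^+ q)^-1.
    by rewrite exprD invfM mulrCA divff ?expf_neq0 // mulr1.
  have Hq : 0 < H ^+ q by rewrite exprn_gt0.
  rewrite -(pmulr_rge0 _ Hq) mulrDr mulrCA [H ^+ q * (_ * _)]mulrA divff ?gt_eqF //
    mul1r.
  by apply: hy; rewrite -mulNr !ler_pM2r ?invr_gt0 // opprB !lerD2r ax.
Qed.

(** For [i < d] this is the [i]-th derivative of [P + tsum d L], in the form of a sequence of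
    explicit functions that the smoothness and monotonicity criteria expect. *)
Definition spline_der (d : nat) P L (i : nat) (x : R) : R :=
  P^`(i).[x] + (d ^_ i)%:R * tsum (d - i) L x.

Lemma is_derive_tsum k L x :
  is_derive x (1 : R) (tsum k.+2 L) (k.+2%:R * tsum k.+1 L x).
Proof.
elim: L => [|e L IH].
  rewrite /tsum big_nil mulr0.
  have -> : (fun x : R => \sum_(e <- [::]) e.1 * tpow e.2 k.+2 x) = cst (0 : R).
    by apply/funext => y; rewrite big_nil.
  exact: is_derive_cst.
have -> : tsum k.+2 (e :: L) = e.1 \*: tpow e.2 k.+2 + tsum k.+2 L.
  by apply/funext => y; rewrite /tsum big_cons.
have h := is_derive_tpow e.2 k x.
apply: (is_derive_eq (is_deriveD (is_deriveZ e.1 h) IH)).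
by rewrite [tsum k.+1 (e :: L) x]/tsum big_cons mulrDr mulrCA.
Qed.

Lemma continuous_tsum k L : continuous (tsum k.+1 L).
Proof.
elim: L => [|e L IH] x.
  have -> : tsum k.+1 [::] = cst (0 : R).
    by apply/funext => y; rewrite /tsum big_nil.
  exact: cvg_cst.
have -> : tsum k.+1 (e :: L) = (fun y => e.1 * tpow e.2 k.+1 y + tsum k.+1 L y).
  by apply/funext => y; rewrite /tsum big_cons.
apply: cvgD; last exact: IH.
by apply: cvgM; [exact: cvg_cst|exact: tpow_continuous].
Qed.

Lemma is_derive_spline d P L i : (i.+1 < d)%N ->
  forall x, is_derive x (1 : R) (spline_der d P L i) (spline_der d P L i.+1 x).
Proof.
move=> id x; have [k kE] : exists k, (d - i = k.+2)%N.
  by exists (d - i - 2)%N; clear -id; lia.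
have -> : spline_der d P L i = horner P^`(i) + (d ^_ i)%:R \*: tsum k.+2 L.
  by apply/funext => y; rewrite /spline_der kE.
have h := is_derive_tsum k L x; have h2 := is_derive_poly P^`(i) x.
apply: (is_derive_eq (is_deriveD h2 (is_deriveZ (d ^_ i)%:R h))).
by rewrite /spline_der -derivnS subnS kE ffactnSr natrM kE -mulrA.
Qed.

End KnotSmoothing.

(** * Lower bound for the modulus of smoothness by the jump *)

Section Modulus.
Variable R : realType.
Implicit Types (p P F : {poly R}) (x y z H : R).

(** With [E] the shift, this is [(1 - E)^(k+1) = (1 - E)^k (1 - E)], obtained from Pascal's rule. *)
Lemma binomial_alternating_rec k (f : nat -> R) :
  \sum_(i < k.+2) 'C(k.+1, i)%:R * (-1) ^+ i * f i =
  \sum_(i < k.+1) 'C(k, i)%:R * (-1) ^+ i * (f i - f i.+1).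
Proof.
rewrite big_ord_recl /= bin0 expr0 !mul1r.
under eq_bigr => i _ do rewrite /bump /= add1n binS natrD exprS !mulrDl.
rewrite big_split /= addrA.
under [RHS]eq_bigr => i _ do rewrite mulrBr.
rewrite sumrB; congr (_ + _); last first.
  by rewrite -sumrN; apply: eq_bigr => i _; ring.
rewrite [in RHS]big_ord_recl /= bin0 expr0 !mul1r; congr (_ + _).
rewrite big_ord_recr /= bin_small // !mul0r addr0.
by apply: eq_bigr => i _; rewrite /bump /= add1n exprS; ring.
Qed.

Lemma finite_difference_poly k p x h : (size p <= k)%N ->
  \sum_(i < k.+1) 'C(k, i)%:R * (-1) ^+ i * p.[x + i%:R * h] = 0.
Proof.
elim: k p => [|k IH] p sp.
  move: sp; rewrite leqn0 size_poly_eq0 => /eqP ->.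
  by rewrite big1 // => i _; rewrite horner0 mulr0.
rewrite (binomial_alternating_rec k (fun i => p.[x + i%:R * h])).
pose p' := p \Po ('X + h%:P).
have sp' : size p' = size p by rewrite size_comp_poly2 // size_XaddC.
rewrite -[RHS](IH (p - p')).
  apply: eq_bigr => i _; rewrite hornerD hornerN horner_comp !hornerE.
  by congr (_ * (_ - _.[_])); rewrite -natr1; ring.
apply/leq_sizeP => j; rewrite leq_eqVlt => /orP[/eqP <-|kj]; last first.
  by rewrite coefB !nth_default ?subrr ?sp' // (leq_trans sp).
move: sp; rewrite leq_eqVlt => /orP[/eqP sp|sp]; last first.
  by rewrite coefB !nth_default ?subrr ?sp'.
have lp : lead_coef p' = lead_coef p.
  by rewrite lead_coef_comp ?size_XaddC // lead_coefXaddC expr1n mulr1.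
by move: lp; rewrite /lead_coef sp' sp /= coefB => ->; rewrite subrr.
Qed.

(** The last node of the difference ranges over an interval supplied by [plateau], on which the jump
    is comparable to its norm. The position of that interval depends on the jump; its length,
    proportional to [H], does not, and this length is what a finite [p] sees. *)
Lemma modulus_ge_jump d : exists c rho : R, [/\ 0 < c, 0 < rho &
  forall (p : \bar R) (s : R -> R) z H (a b : R) P1 P2, (0 < p)%E -> 0 < H ->
    a + H / 2 <= z -> z + H / 2 <= b ->
    (size P1 <= d.+1)%N -> (size P2 <= d.+1)%N ->
    (forall x, a <= x <= z -> s x = P1.[x]) ->
    (forall x, z <= x <= b -> s x = P2.[x]) ->
  ((c * cnorm (rescale z H (P2 - P1)) * len_pow p (rho * H))%:E
     <= modulus_itv (d + 1) s a b p)%E].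
Proof.
(* Since [(k + 1) h0 = 1/2], a stencil of [k] steps [h0 H], plus one further step for moving its
   last node past [z], has total length [H / 2]. *)
pose k := d.+1; pose h0 : R := (2 * k.+1%:R)^-1.
have k0 : 0 < k.+1%:R :> R by rewrite ltr0n.
have h00 : 0 < h0 by rewrite invr_gt0 mulr_gt0.
have kh0 : k.+1%:R * h0 = 1 / 2 by rewrite /h0; field; rewrite gt_eqF.
have kh1 : k%:R * h0 + h0 = 1 / 2 by rewrite -kh0 -natr1 mulrDl mul1r.
pose sg : R := h0 / d.+2%:R.
have d0 : 0 < d.+2%:R :> R by rewrite ltr0n.
have sg0 : 0 < sg by rewrite divr_gt0.
have sgE : d.+2%:R * sg = h0 by rewrite mulrC divfK // gt_eqF.
have kk0 : 0 <= k%:R * h0 by rewrite mulr_ge0 // ltW.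
pose t (i : 'I_d.+1) : R := i.+1%:R * sg.
have tb i : sg <= t i <= h0 - sg.
  have h1 : 1 * sg <= t i by rewrite ler_pM2r // ler1n.
  have h2 : t i <= d.+1%:R * sg by rewrite ler_pM2r // ler_nat ltn_ord.
  have h3 : d.+1%:R * sg + sg = h0 by rewrite -sgE -[d.+2%:R]natr1 mulrDl mul1r.
  by clear -h1 h2 h3; lra.
have tsep (j1 j2 : 'I_d.+1) : j1 != j2 -> sg <= `|t j1 - t j2|.
  wlog lt12 : j1 j2 / (j2 < j1)%N.
    move=> Hw n12; case: (ltngtP j2 j1) => hj; first exact: Hw.
      by rewrite distrC Hw // eq_sym.
    by case/eqP: n12; apply: val_inj.
  move=> _; apply: le_trans (ler_norm _).
  have : j2.+2%:R * sg <= j1.+1%:R * sg by rewrite ler_pM2r // ler_nat.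
  by rewrite -[j2.+2%:R]natr1 mulrDl mul1r /t; clear; lra.
have [||rho [c [/andP[r0 r1] c0 plat]]] :=
  plateau sg0 _ _ tsep (divr_gt0 sg0 (ltr0n _ 2)).
- by have := tb ord0; clear -kh1 kk0 sg0; lra.
- by move=> j; have := tb j; rewrite ler_norml; clear -kh1 kk0 sg0 h00; lra.
exists c, (2 * rho); split=> //; first by rewrite mulr_gt0.
move=> p s z H a b P1 P2 p0 H0 az zb s1 s2 sP1 sP2.
set F := P2 - P1; set F' := rescale z H F.
have sF' : (size F' <= d.+1)%N.
  by rewrite size_rescale ?gt_eqF // (leq_trans (size_polyD _ _)) //
    size_polyN geq_max s2.
have [i hi] := plat F' sF'.
pose h := h0 * H; have h_gt0 : 0 < h by rewrite mulr_gt0.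
have /andP[ti1 ti2] := tb i.
have khH : k%:R * h + h = H / 2.
  by rewrite /h mulrA -mulrDl kh1; clear; lra.
have kh : 0 <= k%:R * h by rewrite mulr_ge0 // ltW.
have dk : (d + 1)%N = k by rewrite addn1.
rewrite /modulus_itv /modulus dk.
apply: (@le_trans _ _ (Lp_norm p `[a, b] (sym_difference k h s `[a, b]))); last first.
  apply: ereal_sup_ubound; exists h => //=; rewrite in_itv /= h_gt0 /=.
  by clear -khH kh az zb H0; lra.
(* Points [x] are centres of the stencil; the shift by [k h / 2] puts the last node at [z + H y]
   with [y] within [rho] of [t i]. *)
pose u := z + H * (t i - rho) - k%:R * h / 2.
pose v := z + H * (t i + rho) - k%:R * h / 2.
have uv : v - u = 2 * rho * H by rewrite /u /v; ring.
rewrite -uv; apply: Lp_norm_ge => //.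
- by rewrite mulr_ge0 ?cnorm_ge0 // ltW.
- have : 0 <= H * (t i - rho) by rewrite mulr_ge0 ?(ltW H0) //; clear -ti1 r1 sg0; lra.
  by rewrite /u; clear -khH kh az h_gt0; lra.
- by rewrite -subr_gt0 uv !mulr_gt0.
- have : H * (t i + rho) <= H * h0 by rewrite ler_pM2l //; clear -ti2 r1 sg0; lra.
  by rewrite [H * h0]mulrC -/h /v; clear -khH kh zb; lra.
move=> x /andP[ux xv].
pose y := (x + k%:R * h / 2 - z) / H.
have xE : x + k%:R * h / 2 = z + H * y.
  by rewrite /y [H * (_ / H)]mulrC divfK ?gt_eqF // subrKC.
have y1 : `|y - t i| <= rho.
  have e1 : H * (t i - rho) <= H * y by move: ux; rewrite /u; clear -xE; lra.
  have e2 : H * y <= H * (t i + rho) by move: xv; rewrite /v; clear -xE; lra.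
  by rewrite !ler_pM2l // in e1 e2; rewrite ler_norml; clear -e1 e2; lra.
have y01 : 0 < y < h0 by move: y1; rewrite ler_norml; clear -ti1 ti2 r1 sg0; lra.
have Hy : 0 < H * y < h.
  by case/andP: y01 => y0 y2; rewrite mulr_gt0 //= /h [h0 * H]mulrC ltr_pM2l.
suff -> : sym_difference k h s `[a, b] x = F'.[y].
  apply: hi => //; move: y01; rewrite ler_norml; clear -kh1 kk0; lra.
have xl : x - k%:R * h / 2 = z + H * y - k%:R * h by rewrite -xE; clear; lra.
rewrite /sym_difference xl xE.
have -> : (z + H * y - k%:R * h \in `[a, b]%classic) && (z + H * y \in `[a, b]%classic).
  apply/andP; split; rewrite inE /= in_itv /=; clear -Hy khH kh az zb h_gt0; lra.
rewrite big_ord_recr /= subnn binn expr0 !mul1r.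
have -> : z + H * y - k%:R * h + k%:R * h = z + H * y by rewrite subrK.
rewrite sP2; last by clear -Hy khH kh zb h_gt0; lra.
rewrite /F' rescale_horner /F hornerD hornerN.
have sgn j : (j <= k)%N -> (-1) ^+ (k - j) = (-1) ^+ k * (-1) ^+ j :> R.
  by move=> jk; rewrite -[in RHS](subnK jk) exprD -mulrA -expr2 sqrr_sign mulr1.
(* The difference annihilates [P1], and [s] equals [P1] at the first [k] nodes, so these terms sum
   to [- P1] at the last node, where [s] equals [P2]. *)
have fd := finite_difference_poly (z + H * y - k%:R * h) h s1.
have {}fd : \sum_(j < k.+1) 'C(k, j)%:R * (-1) ^+ (k - j) *
    P1.[z + H * y - k%:R * h + j%:R * h] = 0.
  transitivity ((-1) ^+ k * \sum_(j < k.+1) 'C(k, j)%:R * (-1) ^+ j *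
      P1.[z + H * y - k%:R * h + j%:R * h]); last by rewrite fd mulr0.
  rewrite mulr_sumr; apply: eq_bigr => j _.
  have jk : (j <= k)%N by rewrite -ltnS.
  rewrite (sgn _ jk); move: (_ ^+ k) (_ ^+ j) (_%:R) (_.[_]) => e1 e2 e3 e4.
  by rewrite mulrA; congr (_ * _); rewrite mulrCA.
rewrite big_ord_recr /= subnn binn expr0 !mul1r subrK in fd.
rewrite -[RHS]addrC; congr (_ + _).
have -> : - P1.[z + H * y] = \sum_(j < k) 'C(k, j)%:R * (-1) ^+ (k - j) *
    P1.[z + H * y - k%:R * h + j%:R * h].
  by apply/eqP; rewrite eq_sym -addr_eq0 fd.
apply: eq_bigr => j _; congr (_ * _); apply: sP1.
have j0 : 0 <= j%:R * h by rewrite mulr_ge0 // ltW.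
have : j.+1%:R * h <= k%:R * h by rewrite ler_pM2r // ler_nat.
by rewrite -natr1 mulrDl mul1r; clear -j0 Hy khH kh az h_gt0; lra.
Qed.

End Modulus.

(** * Gluing the local corrections over all cells *)

Section Assembly.
Variable R : realType.
Implicit Types (P : {poly R}) (x : R) (L : seq (R * R)).

Lemma tsum_flatten k (f : nat -> seq (R * R)) (s : seq nat) x :
  tsum k (flatten [seq f j | j <- s]) x = \sum_(j <- s) tsum k (f j) x.
Proof.
elim: s => [|j s IH] /=; first by rewrite /tsum !big_nil.
by rewrite tsum_cat IH big_cons.
Qed.

(** Lists to the left of the current cell are complete and act as polynomials; those to the right
    have not started. *)
Lemma tsum_localize k n (f : nat -> seq (R * R)) (j0 : nat) x : (j0 <= n)%N ->
  (forall j e, (j < j0)%N -> e \in f j -> e.2 <= x) ->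
  (forall j e, (j0 < j)%N -> (j <= n)%N -> e \in f j -> x < e.2) ->
  tsum k (flatten [seq f j | j <- index_iota 0 n.+1]) x =
  (\sum_(0 <= j < j0) psum k (f j)).[x] + tsum k (f j0) x.
Proof.
move=> jn below above; rewrite tsum_flatten.
rewrite (big_cat_nat (n := j0)) //= ?leqW // horner_sum; congr (_ + _).
  rewrite big_nat [RHS]big_nat; apply: eq_bigr => j /andP[_ jj].
  by rewrite tsum_right // => e; apply: below.
rewrite big_ltn // big_nat big1 ?addr0 // => j /andP[jj jn'].
by rewrite tsum_left // => e; apply: above.
Qed.

Lemma spline_piecewise K m d P L : (forall e, e \in L -> exists2 i,
  (i <= m)%N & e.2 = knot R K m i) ->
  (size P <= d.+1)%N ->
  piecewise_poly d (knot R K m) m (fun x => P.[x] + tsum d L x).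
Proof.
move=> LT sP i im; exists (P + psum d [seq e <- L | e.2 <= knot R K m i]).
  by rewrite (leq_trans (size_polyD _ _)) // geq_max sP size_psum.
move=> x /andP[ix xi]; rewrite hornerD psum_horner big_filter; congr (_ + _).
rewrite /tsum [RHS]big_mkcond /=; apply: eq_big_seq => e eL.
case: ifP => h; first by rewrite tpow_right // (le_trans h) // ltW.
have [l lm el] := LT e eL; rewrite tpow_left ?mulr0 //.
apply: lt_le_trans xi _; rewrite el knot_le //.
rewrite ltnNge; apply: contraFN h => li; rewrite el; apply: knot_le => //.
exact: ltnW.
Qed.

(** The convention [z_(-1) = z_0] is reproduced by [0.-1 = 0] on natural numbers. *)
Lemma cell_leftE (z : nat -> R) n j : (j <= n)%N ->
  cell_left z n j = (z j.-1 + z j) / 2.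
Proof.
move=> jn; rewrite /cell_left; congr ((_ + _) / 2); last first.
  by rewrite /= (minn_idPl jn).
case: j jn => [//|j] jn.
have -> : j.+1%:Z - 1 = j%:Z by lia.
by rewrite /= (minn_idPl (ltnW jn)).
Qed.

Lemma cell_rightE (z : nat -> R) n j : (j <= n)%N ->
  cell_right z n j = (z j + z (minn j.+1 n)) / 2.
Proof.
move=> jn; rewrite /cell_right; congr ((_ + _) / 2).
  by rewrite /= (minn_idPl jn).
by have -> : j%:Z + 1 = j.+1%:Z by lia.
Qed.

Lemma modulus_ge0 k (f : R -> R) (a b : R) p : a < b ->
  (0 <= modulus_itv k f a b p)%E.
Proof.
move=> ab; rewrite /modulus_itv /modulus.
apply: le_trans (ereal_sup_ubound _); last first.
  by exists (b - a) => //=; rewrite in_itv /= subr_gt0 ab lexx.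
exact: Lnorm_ge0.
Qed.

End Assembly.

Theorem corollary1p3 (R : realType) (q r : nat) (hq : (0 < q)%N)
    (hr : (0 < r)%N) :
  exists m0 : nat, (0 < m0)%N /\
  exists c : \bar R -> R, (forall p : \bar R, (0 < p)%E -> 0 < c p) /\
  forall (K : partition_kind) (n : nat), (0 < n)%N ->
  forall s : R -> R,
    piecewise_poly (q + r) (knot R K n) n s ->
    q_monotone q (- 1) 1 s ->
    Ck q.-1 (- 1) 1 s ->
  forall m : nat, (m0 * n <= m)%N ->
  exists st : R -> R,
    smooth_spline (q + r) (knot R K m) m st /\
    q_monotone q (- 1) 1 st /\
    forall p : \bar R, (0 < p)%E ->
    forall j : nat, (j <= n)%N ->
      let a := cell_left (knot R K n) n j in
      let b := cell_right (knot R K n) n j in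
      (Lp_norm p `[a, b] (fun x : R => s x - st x)%R
        <= (c p)%:E * modulus_itv (q + r + 1) s a b p)%E.
Proof.
have [k [C [k0 C0 smoothP]]] := smoothing_at_knot R q r.
have [m0 [m00 geomP]] := knot_local_geometry k0.
have [c [rho [c0 rho0 modP]]] := modulus_ge_jump R (q + r).
(* The factor [4 / rho] compares the cell, of length at most [4 H], with the interval of length
   [rho H] on which the difference is large. *)
exists m0; split=> //; exists (fun p => C / c * len_pow p (4 / rho)); split.
  by move=> p _; rewrite mulr_gt0 ?len_pow_gt0 ?divr_gt0.
move=> K n n0 s sP sq sC m mn.
set d := (q + r)%N; set z := knot R K n.
have zlt i j : (i < j)%N -> (j <= n)%N -> z i < z j by apply: knot_lt.
have zle i j : (i <= j)%N -> (j <= n)%N -> z i <= z j by apply: knot_le.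
have z0 : z 0%N = -1 by apply: knot0.
have zn : z n = 1 by apply: knotn.
have zge i : (i <= n)%N -> -1 <= z i by move=> iN; rewrite -z0 zle.
have zle1 i : (i <= n)%N -> z i <= 1 by move=> iN; rewrite -zn zle.
have /choice[P hP] : forall i, exists P : {poly R}, (i < n)%N ->
    (size P <= d.+1)%N /\ forall x, z i < x < z i.+1 -> s x = P.[x].
  move=> i; case: (ltnP i n) => iN; last by exists 0.
  by have [P sizeP PE] := sP i iN; exists P.
have Psize i : (i < n)%N -> (size (P i) <= d.+1)%N by move=> /hP[].
have Popen i x : (i < n)%N -> z i < x < z i.+1 -> s x = (P i).[x].
  by move=> /hP[_]; apply.
have Pclosed i x : (i < n)%N -> z i <= x <= z i.+1 -> s x = (P i).[x].
  move=> iN /andP[x1 x2].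
  have [e1 e2] := poly_at_ends (Ck_continuous sC) (zge i (ltnW iN)) (zlt i i.+1
    (ltnSn i) iN)
    (zle1 i.+1 iN) (fun x => Popen i x iN).
  move: x1 x2; rewrite !le_eqVlt => /orP[/eqP <- //|x1] /orP[/eqP -> //|x2].
  by apply: Popen => //; rewrite x1.
have Ppos i x : (i < n)%N -> z i <= x <= z i.+1 -> 0 <= (P i)^`(q).[x].
  move=> iN; apply: (q_monotone_poly sq (zge i (ltnW iN)) (zlt i i.+1 (ltnSn i) iN)
    (zle1 i.+1 iN) (fun x => Popen i x iN)).
have Pmatch i l : (i.+1 < n)%N -> (l < q)%N ->
    (P i)^`(l).[z i.+1] = (P i.+1)^`(l).[z i.+1].
  move=> iN lq; have iN' := ltnW iN.
  apply: (Ck_match sC (zge i (ltnW iN')) (zlt i i.+1 (ltnSn i) iN')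
    (zlt i.+1 i.+2 (ltnSn _) iN) (zle1 i.+2 iN) (fun x => Popen i x iN')
    (fun x => Popen i.+1 x iN)).
  by rewrite -ltnS prednK.
(* Each interior knot receives a list together with its mesh size; the end knots receive the empty
   list, as [s] has no break there. *)
have /choice[f hf] : forall j, exists f : seq (R * R) * R,
    if (0 < j < n)%N then
      [/\ 0 < f.2, f.2 <= z j - z j.-1 <= 4 * f.2, f.2 <= z j.+1 - z j <= 4 * f.2 &
        forall e, e \in f.1 -> (exists2 i, (i <= m)%N & e.2 = knot R K m i) /\
           `|e.2 - z j| <= f.2 / 4] /\
      [/\ psum d f.1 = P j - P j.-1,
        forall x, `|(if z j <= x then (P j - P j.-1).[x] else 0) - tsum d f.1 x|
          <= C * cnorm (rescale (z j) f.2 (P j - P j.-1)) &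
        forall x, z j.-1 <= x <= z j.+1 ->
          0 <= (P j.-1)^`(q).[x] + (d ^_ q)%:R * tsum r f.1 x]
    else f.1 = [::].
  move=> j; case: (boolP (0 < j < n)%N) => [jn01|/negbTE jn01]; last first.
    by exists ([::], 0).
  have [j0 jn] := andP jn01.
  have [H [H0 gl gr near_knot]] := geomP K n j j0 jn.
  have jE : j.-1.+1 = j by rewrite prednK.
  have jn' : (j.-1 < n)%N by rewrite jE ltnW.
  have [||||||L [LT Lp Le Lpos]] := smoothP (fun t =>
    exists2 i, (i <= m)%N & t = knot R K m i)
    (z j) H H0 _ (P j.-1) (P j) (z j.-1) (z j.+1) (Psize _ jn') (Psize _ jn).
  - move=> x xz; have [i im ix] := near_knot m x mn xz.
    by exists (knot R K m i) => //; exists i.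
  - by move=> i iq; have := Pmatch j.-1 i; rewrite jE; apply.
  - by clear -gl; rewrite -/z in gl; lra.
  - by clear -gr; rewrite -/z in gr; lra.
  - by move=> x x12; apply: Ppos => //; rewrite jE.
  - by move=> x x12; apply: Ppos.
  by exists (L, H).
pose L := flatten [seq (f j).1 | j <- index_iota 0 n.+1].
(* As [H / 4] is less than half of each adjacent gap, the lists lie strictly inside their cells and
   do not interact. *)
have inner j e : e \in (f j).1 -> (0 < j < n)%N /\
    (z j.-1 + z j) / 2 < e.2 < (z j + z j.+1) / 2.
  have := hf j; case: ifPn => [jn [[H0 gl gr fe] _] /fe[_ ez]|_ -> //]; split=> //.
  by move: ez; rewrite ler_norml; clear -H0 gl gr; lra.
pose cell j x := (z j.-1 + z j) / 2 <= x <= (z j + z (minn j.+1 n)) / 2.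
(* Exact jumps telescope, so cell [j] starts from the original piece [P j.-1]; for [j = 0] the sum
   is empty and [0.-1 = 0]. *)
have tel j : (j <= n)%N -> \sum_(0 <= i < j) psum d (f i).1 = P j.-1 - P 0%N.
  elim: j => [|j IH] jn; first by rewrite big_geq // subrr.
  rewrite big_nat_recr //= IH ?(ltnW jn) //; have := hf j; case: (posnP j) => [->|j0].
    by rewrite /= => ->; rewrite /psum big_nil addr0.
  by rewrite jn /= => -[_ [-> _ _]]; rewrite addrC subrKA.
have locL l j x : (j <= n)%N -> cell j x -> tsum l L x =
    (\sum_(0 <= i < j) psum l (f i).1).[x] + tsum l (f j).1 x.
  move=> jn /andP[x1 x2]; apply: tsum_localize => // i e.
    move=> ij /inner[/andP[i0 iN] /andP[_ he]].
    have j0 : (0 < j)%N by apply: leq_trans ij.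
    have h1 : z i <= z j.-1 by apply: zle;
      rewrite ?(leq_trans (leq_pred j)) // -ltnS prednK.
    have h2 : z i.+1 <= z j by apply: zle.
    by clear -x1 he h1 h2; lra.
  move=> ji _ /inner[/andP[i0 iN] /andP[he _]].
  rewrite (minn_idPl (ltn_trans ji iN)) in x2.
  have h1 : z j <= z i.-1.
    by apply: zle; [rewrite -ltnS prednK|rewrite (leq_trans (leq_pred i)) // ltnW].
  have h2 : z j.+1 <= z i by apply: zle => //; apply: ltnW.
  by clear -x2 he h1 h2; lra.
have find_cell x : -1 <= x <= 1 -> exists2 j, (j <= n)%N & cell j x.
  move=> /andP[x1 x2]; have [||i iN /andP[zi iz]] := @bracket R z n x _ _ n0.
  - by rewrite z0.
  - by rewrite zn.
  case: (lerP x ((z i + z i.+1) / 2)) => h.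
    exists i; first exact: ltnW.
    rewrite /cell (minn_idPl iN) h andbT.
    by have := zle i.-1 i (leq_pred i) (ltnW iN); clear -zi; lra.
  exists i.+1 => //; rewrite /cell (ltW h) /=.
  have : z i.+1 <= z (minn i.+2 n) by apply: zle; rewrite ?geq_minr // leq_min leqW.
  by clear -iz; lra.
(* The global formula gives smoothness at once; the cellwise formulas derived from it give the sign
   and the error estimate. *)
pose st x := (P 0%N).[x] + tsum d L x.
have stE j x : (j <= n)%N -> cell j x -> st x = (P j.-1).[x] + tsum d (f j).1 x.
  move=> jn cx; rewrite /st (locL d j) // tel // hornerD hornerN.
  by rewrite addrA [(P 0%N).[x] + _]addrC subrK.
have derE j x : (j <= n)%N -> cell j x -> spline_der d (P 0%N) L q x =
    (P j.-1)^`(q).[x] + (d ^_ q)%:R * tsum r (f j).1 x.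
  move=> jn cx; rewrite /spline_der addKn (locL r j) // mulrDr addrA; congr (_ + _).
  rewrite -hornerZ -hornerD scaler_sumr.
  under eq_bigr => i _ do rewrite -derivn_psum.
  by rewrite -linear_sum tel //= derivnB subrKC.
have der_pos x : -1 <= x <= 1 -> 0 <= spline_der d (P 0%N) L q x.
  move=> /find_cell[j jn cx]; rewrite (derE j) //; move: (cx) => /andP[x1 x2].
  have := hf j; case: ifPn => [/andP[j0 jN] [[H0 gl gr _] [_ _ pos]]|jn' ->].
    apply: pos; rewrite (minn_idPl jN) in x2.
    by clear -x1 x2 H0 gl gr; lra.
  rewrite /tsum big_nil mulr0 addr0; case: (posnP j) => [j0|j0].
    move: x1 x2; rewrite j0 /= (minn_idPl n0) => x1 x2; apply: Ppos => //.
    by have h := zlt 0%N 1%N (ltn0Sn 0) n0; clear -x1 x2 h; lra.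
  have jE : j = n by apply/eqP; rewrite eqn_leq jn leqNgt; rewrite j0 in jn'.
  have nE : n.-1.+1 = n by rewrite prednK.
  apply: Ppos; first by rewrite jE nE.
  move: x1 x2; rewrite jE nE (minn_idPr (leqnSn n)).
  have := zlt n.-1 n; rewrite nE => /(_ (leqnn _) (leqnn _)); clear => h1 h2 h3; lra.
have der0 : spline_der d (P 0%N) L 0 = st.
  by apply/funext => x; rewrite /spline_der derivn0 ffactn0 mul1r subn0.
have LT e : e \in L -> exists2 i, (i <= m)%N & e.2 = knot R K m i.
  move=> /flatten_mapP[j _]; have := hf j.
  by case: ifP => [_ [[_ _ _ fe] _] /fe[]|_ -> //].
exists st; split; last split.
- split; first by apply: spline_piecewise => //; apply: Psize.
  rewrite -der0; apply: Ck_is_derive => [i id|].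
    by apply: is_derive_spline; rewrite -ltnS prednK // addn_gt0 hq in id *.
  (* The derivative of order [d - 1] involves truncated powers of degree 1, which are still
     continuous. *)
  have dd : (d - d.-1 = 1)%N by rewrite -subn1 subKn // addn_gt0 hq.
  move=> x; apply: cvgD; first exact: continuous_horner.
  by rewrite dd; apply: cvgM; [exact: cvg_cst|exact: continuous_tsum].
- rewrite -der0; apply: q_monotone_derive => // i iq x.
  by apply: is_derive_spline; rewrite /d -addn1 leq_add.
move=> p p0 j jn; cbv zeta; set a := cell_left z n j; set b := cell_right z n j.
have aE : a = (z j.-1 + z j) / 2 by apply: cell_leftE.
have bE : b = (z j + z (minn j.+1 n)) / 2 by apply: cell_rightE.
have cp0 : 0 < C / c * len_pow p (4 / rho) by rewrite mulr_gt0 ?len_pow_gt0 ?divr_gt0.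
have cellE x : a <= x <= b -> cell j x by rewrite aE bE.
have := hf j; case: ifPn => [/andP[j0 jN] [[H0 gl gr _] [_ err _]]|jn' fj].
  set H := (f j).2 in H0 gl gr err; set N := cnorm _ in err.
  rewrite (minn_idPl jN) in bE.
  have jE : j.-1.+1 = j by rewrite prednK.
  have jn' : (j.-1 < n)%N by rewrite jE.
  have s1 x : a <= x <= z j -> s x = (P j.-1).[x].
    move=> xz; apply: Pclosed => //; rewrite jE; clear -xz aE H0 gl; lra.
  have s2 x : z j <= x <= b -> s x = (P j).[x].
    move=> xz; apply: Pclosed => //; clear -xz bE H0 gr; lra.
  have up : (Lp_norm p `[a, b] (fun x =>
    (s x - st x)%R) <= (C * N * len_pow p (4 * H))%:E)%E.
    have N0 : 0 <= C * N by rewrite mulr_ge0 ?cnorm_ge0 // ltW.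
    apply: le_trans (Lp_norm_le (M := C * N) p0 _ N0 _) _.
    - by rewrite aE bE; clear -H0 gl gr; lra.
    - move=> x xab; have [x1 x2] := andP xab; rewrite (stE j x jn (cellE x xab)).
      have := err x; case: (lerP (z j) x) => zx.
        have -> : s x = (P j).[x] by apply: s2; rewrite zx.
        by rewrite hornerD hornerN [- (_ + tsum _ _ _)]opprD addrA.
      have -> : s x = (P j.-1).[x] by apply: s1; rewrite x1 ltW.
      by rewrite [- (_ + tsum _ _ _)]opprD addrA subrr.
    by rewrite lee_fin ler_wpM2l // len_pow_le // aE bE; clear -H0 gl gr; lra.
  have low := @modP p s (z j) H a b (P j.-1) (P j) p0 H0 _ _ (Psize _ jn') (Psize _
    jN) s1 s2.
  apply: le_trans up _.
  have -> : C * N * len_pow p (4 * H) =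
      C / c * len_pow p (4 / rho) * (c * N * len_pow p (rho * H)).
    have -> : 4 * H = (4 / rho) * (rho * H) by field; rewrite gt_eqF.
    rewrite len_powM ?divr_ge0 ?mulr_ge0 ?ltW //.
    by field; rewrite gt_eqF.
  rewrite EFinM lee_pmul2l ?lte_fin //; apply: low; rewrite ?aE ?bE; clear -H0 gl gr;
    lra.
(* On an end cell [st] coincides with [s], so the error norm is at most 0, while [a < b] makes the
   modulus nonnegative. *)
have ab : a < b.
  have h : z j.-1 < z (minn j.+1 n).
    apply: zlt; last exact: geq_minr.
    by rewrite leq_min ltnS leq_pred; case: (j) jn => [|j'] //=.
  by rewrite aE bE; clear -h; lra.
apply: (@le_trans _ _ 0%E); last first.
  by rewrite mule_ge0 ?modulus_ge0 // lee_fin ltW.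
have := @Lp_norm_le R p a b 0 (fun x => s x - st x) p0 (ltW ab) (lexx 0).
rewrite mul0r; apply => x xab.
rewrite (stE j x jn (cellE x xab)) fj /tsum big_nil addr0.
suff -> : s x = (P j.-1).[x] by rewrite subrr normr0.
move: xab; rewrite aE bE => xab; case: (posnP j) => [j0|j0].
  move: xab; rewrite j0 /= (minn_idPl n0) => xab; apply: Pclosed => //.
  by have h := zlt 0%N 1%N (ltn0Sn 0) n0; clear -xab h; lra.
have jE : j = n by apply/eqP; rewrite eqn_leq jn leqNgt; rewrite j0 in jn'.
have nE : n.-1.+1 = n by rewrite prednK.
move: xab; rewrite jE (minn_idPr (leqnSn n)) => xab; apply: Pclosed; rewrite nE //.
have := zlt n.-1 n; rewrite nE => /(_ (leqnn _) (leqnn _)); clear -xab => h; lra.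
Qed.
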